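(* Let $\beta\in\mathbb{C}^d$ and $j\in\{1,\dots,n\}$. The following are equivalent: (1) $\beta\notin\mathrm{SRes}_j(A)$; (2) left multiplication by $\partial_j$ is a quasi-isomorphism of the complex $K_\bullet(S_A,\beta)$ to itself.
   Context: $A=(a_{i,j})$ is an integer $d\times n$ matrix with columns $\mathbf a_1,\dots,\mathbf a_n$, $\mathbb{Z}A=\mathbb{Z}^d$, $\mathbb{N}A$ positive. $D_A$ is the Weyl algebra in $x_1,\dots,x_n,\partial_1,\dots,\partial_n$, $R_A=\mathbb{C}[\partial_1,\dots,\partial_n]$, $I_A$ the toric ideal (generated by $\partial^{\mathbf u_+}-\partial^{\mathbf u_-}$, $A\mathbf u=0$), $S_A=R_A/I_A$, all $\mathbb{Z}^d$-graded by $\deg x_j=\mathbf a_j=-\deg\partial_j$. $E_i=\sum_j a_{i,j}x_j\partial_j$. For a $\mathbb{Z}^d$-graded $R_A$-module $N$, $K_\bullet(N,\beta)$ is the Koszul complex on $D_A\otimes_{R_A}N$ of the commuting $D_A$-linear endomorphisms $y\mapsto(E_i-\beta_i-\deg_i(y))y$ ($y$ homogeneous), $i=1,\dots,d$. For a finitely generated $\mathbb{Z}^d$-graded $R_A$-module $M$, the quasi-degrees $\operatorname{qdeg}(M)\subseteq\mathbb{C}^d$ are the Zariski closure of $\{\alpha\in\mathbb{Z}^d\mid M_\alpha\neq0\}$. Define $\mathrm{SRes}_j(A)=\{\beta\in\mathbb{C}^d\mid -\beta\in(k+1)\mathbf a_j+\operatorname{qdeg}(S_A/\langle\partial_j\rangle)\text{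 for some }k\in\mathbb{N}\}$. *)

(* Defs.v *)
From mathcomp Require Import all_boot all_order all_algebra.
From mathcomp Require Import mpoly.
From mathcomp Require Import complex.
From mathcomp Require Import Rstruct.

Set Implicit Arguments.
Unset Strict Implicit.
Unset Printing Implicit Defensive.
Import Order.TTheory GRing.Theory Num.Theory.
Local Open Scope ring_scope.

Definition CC : numClosedFieldType := (Rdefinitions.R)[i].

Definition Amul (d n : nat) (A : 'M[int]_(d, n)) (u : 'I_n -> int) : 'I_d -> int :=
  fun i => \sum_(k < n) A i k * u k.

Definition ZA_full (d n : nat) (A : 'M[int]_(d, n)) : Prop :=
  forall v : 'I_d -> int, exists u : 'I_n -> int, forall i, Amul A u i = v i.

Definition NA_positive (d n : nat) (A : 'M[int]_(d, n)) : Prop :=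
  forall u w : 'I_n -> nat,
    (forall i, Amul A (fun k => (u k)%:Z) i = - Amul A (fun k => (w k)%:Z) i) ->
    forall i, Amul A (fun k => (u k)%:Z) i = 0.

(* R_A = C[∂_1, ..., ∂_n] = {mpoly CC[n]}; the toric ideal I_A.       *)

Definition in_ideal (m : nat) (G : {mpoly CC[m]} -> Prop) (p : {mpoly CC[m]}) : Prop :=
  exists s : seq ({mpoly CC[m]} * {mpoly CC[m]}),
    (forall q, q \in s -> G q.2) /\ p = \sum_(q <- s) q.1 * q.2.

Definition upos (n : nat) (u : 'I_n -> int) : 'X_{1..n} :=
  [multinom `|Order.max (u i) 0|%N | i < n].

Definition binom (n : nat) (u : 'I_n -> int) : {mpoly CC[n]} :=
  'X_[upos u] - 'X_[upos (fun i => - u i)].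

Definition toric_gen (d n : nat) (A : 'M[int]_(d, n)) (p : {mpoly CC[n]}) : Prop :=
  exists u : 'I_n -> int, (forall i, Amul A u i = 0) /\ p = binom u.

Definition toric_ideal (d n : nat) (A : 'M[int]_(d, n)) : {mpoly CC[n]} -> Prop :=
  in_ideal (toric_gen A).

(* the ideal I_A + <∂_j> of R_A, so that R_A/(I_A + <∂_j>) = S_A/<∂_j> *)
Definition toric_ideal_dj (d n : nat) (A : 'M[int]_(d, n)) (j : 'I_n)
  : {mpoly CC[n]} -> Prop :=
  in_ideal (fun g => toric_gen A g \/ g = 'X_j).

Definition degR (d n : nat) (A : 'M[int]_(d, n)) (m : 'X_{1..n}) : 'I_d -> int :=
  fun i => - Amul A (fun k => (m k)%:Z) i.

Definition SAdj_piece_nonzero (d n : nat) (A : 'M[int]_(d, n)) (j : 'I_n)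
  (alpha : 'I_d -> int) : Prop :=
  exists p : {mpoly CC[n]},
    (forall m, m \in msupp p -> forall i, degR A m i = alpha i) /\
    ~ toric_ideal_dj A j p.

Definition zariski_closure (d : nat) (S : ('I_d -> int) -> Prop) (z : 'I_d -> CC) : Prop :=
  forall f : {mpoly CC[d]},
    (forall alpha, S alpha -> f.@[fun i => (alpha i)%:~R] = 0) -> f.@[z] = 0.

Definition qdeg_SAdj (d n : nat) (A : 'M[int]_(d, n)) (j : 'I_n) : ('I_d -> CC) -> Prop :=
  zariski_closure (SAdj_piece_nonzero A j).

Definition SRes (d n : nat) (A : 'M[int]_(d, n)) (j : 'I_n) (beta : 'I_d -> CC) : Prop :=
  exists k : nat,
    qdeg_SAdj A j (fun i => - beta i - (k.+1)%:R * (A i j)%:~R).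

(* The Weyl algebra D_A: elements are written in normal order
   sum c_{a,b} x^a ∂^b and represented by {mpoly CC[n + n]}, where
   variable (lshift n k) stands for x_k and (rshift n k) for ∂_k.     *)
Definition xv (n : nat) (k : 'I_n) : 'I_(n + n) := lshift n k.
Definition dv (n : nat) (k : 'I_n) : 'I_(n + n) := rshift n k.

Definition xpart (n : nat) (al : 'X_{1..n}) : 'X_{1..n + n} :=
  [multinom (if split i is inl k then al k else 0%N) | i < n + n].
Definition dpart (n : nat) (al : 'X_{1..n}) : 'X_{1..n + n} :=
  [multinom (if split i is inr k then al k else 0%N) | i < n + n].

(* product in the Weyl algebra of normally ordered symbols:
   P * Q = sum_alpha 1/alpha! (∂_∂^alpha P) (∂_x^alpha Q)
   (all nonzero terms have |alpha| < msize P). *)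
Definition weyl_mul (n : nat) (P Q : {mpoly CC[n + n]}) : {mpoly CC[n + n]} :=
  \sum_(al : 'X_{1..n < msize P})
    ((\prod_(k < n) ((val al) k)`!)%:R)^-1 *:
      (P^`M[dpart (val al)] * Q^`M[xpart (val al)]).

Definition embR (n : nat) (p : {mpoly CC[n]}) : {mpoly CC[n + n]} :=
  \sum_(m <- msupp p) p@_m *: 'X_[dpart m].

Definition in_DIA (d n : nat) (A : 'M[int]_(d, n)) (P : {mpoly CC[n + n]}) : Prop :=
  exists s : seq ({mpoly CC[n + n]} * {mpoly CC[n]}),
    (forall q, q \in s -> toric_ideal A q.2) /\
    P = \sum_(q <- s) weyl_mul q.1 (embR q.2).

(* equality in D_A ⊗_{R_A} S_A = D_A / D_A I_A *)
Definition modeq (d n : nat) (A : 'M[int]_(d, n)) (P Q : {mpoly CC[n + n]}) : Prop :=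
  in_DIA A (P - Q).

Definition degD (d n : nat) (A : 'M[int]_(d, n)) (m : 'X_{1..n + n}) : 'I_d -> int :=
  fun i => Amul A (fun k => (m (xv k))%:Z - (m (dv k))%:Z) i.

Definition Euler (d n : nat) (A : 'M[int]_(d, n)) (i : 'I_d) : {mpoly CC[n + n]} :=
  \sum_(k < n) (A i k)%:~R *: 'X_[(U_(xv k) + U_(dv k))%MM].

(* y |-> (E_i - beta_i - deg_i(y)) y on homogeneous y, extended linearly *)
Definition kphi (d n : nat) (A : 'M[int]_(d, n)) (beta : 'I_d -> CC) (i : 'I_d)
  (P : {mpoly CC[n + n]}) : {mpoly CC[n + n]} :=
  weyl_mul (Euler A i) P
  - \sum_(m <- msupp P) (P@_m * (beta i + (degD A m i)%:~R)) *: 'X_[m].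

(* The Koszul complex K_.(S_A, beta): a chain of degree k assigns to each
   k-subset sigma of {1..d} a coefficient in D_A ⊗ S_A (basis element
   e_sigma); values on other subsets are irrelevant.
   Differential: d(y e_sigma) = sum_{i in sigma} (-1)^{#{l in sigma, l < i}}
   phi_i(y) e_{sigma \ i}; its tau-component is computed below.          *)
Definition kdiff (d n : nat) (A : 'M[int]_(d, n)) (beta : 'I_d -> CC)
  (c : {set 'I_d} -> {mpoly CC[n + n]}) (tau : {set 'I_d}) : {mpoly CC[n + n]} :=
  \sum_(i < d | i \notin tau)
     ((-1) ^+ #|[set l in tau | (l < i)%N]|) *: kphi A beta i (c (i |: tau)).

Definition kcycle (d n : nat) (A : 'M[int]_(d, n)) (beta : 'I_d -> CC) (k : nat)
  (c : {set 'I_d} -> {mpoly CC[n + n]}) : Prop :=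
  forall tau : {set 'I_d}, #|tau|.+1 = k -> modeq A (kdiff A beta c tau) 0.

Definition kboundary (d n : nat) (A : 'M[int]_(d, n)) (beta : 'I_d -> CC) (k : nat)
  (c : {set 'I_d} -> {mpoly CC[n + n]}) : Prop :=
  exists b : {set 'I_d} -> {mpoly CC[n + n]},
    forall sigma : {set 'I_d}, #|sigma| = k -> modeq A (c sigma) (kdiff A beta b sigma).

Definition mul_dj (n : nat) (j : 'I_n) (d : nat) (c : {set 'I_d} -> {mpoly CC[n + n]})
  : {set 'I_d} -> {mpoly CC[n + n]} :=
  fun sigma => weyl_mul 'X_(dv j) (c sigma).

Definition dj_quasi_iso (d n : nat) (A : 'M[int]_(d, n)) (beta : 'I_d -> CC)
  (j : 'I_n) : Prop :=
  forall k : nat,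
    (forall c, kcycle A beta k c -> kboundary A beta k (mul_dj j c) ->
               kboundary A beta k c) /\
    (forall c, kcycle A beta k c ->
       exists c', kcycle A beta k c' /\
         kboundary A beta k (fun sigma => mul_dj j c' sigma - c sigma)).

(* Main.v *)
Require Import Defs.
From HB Require Import structures.
From mathcomp Require Import all_boot all_order all_algebra.
From mathcomp Require Import ssrcomplements mpoly.
From mathcomp Require Import complex.
From mathcomp Require Import Rstruct.
From mathcomp Require Import ring zify.
From Stdlib Require Import Classical IndefiniteDescription.

(* Reading symbols in normal order identifies D_A (x) S_A with C[x][NA], the class of
   d^u becoming t^(Au). There the i-th Koszul endomorphism is
   phi_i (x^a t^b) = (b_i - beta_i) x^a t^b + sum_k a_ik x^(a+e_k) t^(b+a_k), and left
   multiplication by d_j is delta = d/dx_j + t^(a_j), which is injective and commutes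
   with every phi_i.

   If beta is not strongly resonant, each monomial is sent into the image of delta by
   some operator of the form 1 + sum_i phi_i h_i: NA \ (a_j + NA) is covered by
   finitely many cells v + N^J, and on the cell of x^a t^b a linear form vanishing on
   a_k, k in J, provides an operator 1 + sum_i w_i phi_i which, modulo delta, leaves
   only monomials in later cells. Such operators are homotopic to a map that is
   invertible up to boundaries, so the cokernel complex of delta is acyclic.

   If beta is strongly resonant, the cokernel of delta is C[x'] (x) C[E] with
   E = (NA - N a_j) \ (a_j + NA), where x_j^m t^b becomes (-1)^m m! t^(b - m a_j).
   Some cell of E has beta + a_j in its Zariski closure, and products of functions
   with g(z+1) = (z - t) g(z) along independent columns of this cell give a nonzero
   functional on D_A (x) S_A that vanishes on the images of delta and of all phi_i.
   Hence delta is not surjective on H_0. *)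

Set Implicit Arguments.
Unset Strict Implicit.
Unset Printing Implicit Defensive.
Import Order.TTheory GRing.Theory Num.Theory.
Local Open Scope ring_scope.

(** * Monomial ideals, linear forms and polynomials *)

Lemma fin_uniform_bound (T : finType) (P : T -> nat -> Prop) :
  (forall x k l, (k <= l)%N -> P x k -> P x l) ->
  (forall x, exists k, P x k) -> exists k, forall x, P x k.
Proof.
move=> Pmono /(fin_all_exists (U := fun=> nat)) [f Pf].
exists (\max_x f x)%N => x; apply: Pmono (Pf x); exact: (leq_bigmax x).
Qed.

(** Dickson's lemma in truncated form, by induction on [n]. The slices of [U] at first coordinate
    [k] grow with [k]; each slice, and also their union, is an upset in one variable fewer and so
    has a bound. *)
Lemma upset_trunc n (U : ('I_n -> nat) -> Prop) :
  (forall u v, (forall i, u i <= v i)%N -> U u -> U v) ->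
  exists B, forall u, U u -> U (fun i => minn (u i) B).
Proof.
elim: n U => [|n IHn] U Umono.
  by exists 0%N => u; apply: Umono => -[].
pose cons k (u : 'I_n -> nat) (i : 'I_n.+1) := oapp u k (unlift ord0 i).
have le_cons k l u (v : 'I_n.+1 -> nat) : (k <= l)%N -> (l <= v ord0)%N ->
    (forall i, u i <= v (lift ord0 i))%N -> forall i, (cons k u i <= v i)%N.
  move=> kl lv uv i; rewrite /cons; case: unliftP => [i'|] -> //=.
  exact: leq_trans lv.
have cons_mono k l u v : (k <= l)%N -> (forall i, u i <= v i)%N ->
    U (cons k u) -> U (cons l v).
  move=> kl uv; apply: Umono; apply: (le_cons _ l) => //.
    by rewrite /cons unlift_none.
  by move=> i; rewrite /cons liftK.
have [Binf HBinf] : exists B, forall u, (exists k, U (cons k u)) ->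
    exists k, U (cons k (fun i => minn (u i) B)).
  apply: (IHn (fun u => exists k, U (cons k u))) => u v uv [k Uk].
  by exists k; apply: cons_mono Uk.
have HB k : exists B, forall u, U (cons k u) -> U (cons k (fun i => minn (u i) B)).
  by apply: (IHn (fun u => U (cons k u))) => u v uv; apply: cons_mono.
(* The box of vectors truncated at [Binf] is finite, so those lying in some slice all lie in slice
   [k0]. Only the slices up to [k0] still need bounds of their own. *)
have [k0 Hk0] : exists k0, forall v : {ffun 'I_n -> 'I_Binf.+1},
    (exists k, U (cons k (fun i => v i))) -> U (cons k0 (fun i => v i)).
  apply: fin_uniform_bound => [v k l kl H /H|v]; first exact: cons_mono.
  case: (classic (exists k, U (cons k (fun i => v i)))) => [[k Uk]|noU]; first by exists k.
  by exists 0%N.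
have [B1 HB1] : exists B, forall k : 'I_k0.+1, forall u, U (cons k u) ->
    U (cons k (fun i => minn (u i) B)).
  apply: fin_uniform_bound => [k B C BC H u /H|k]; last exact: HB.
  by apply: cons_mono => // i; rewrite leq_min geq_minl /= (leq_trans (geq_minr _ _)).
exists (maxn (maxn Binf k0) B1) => u Uu.
set B := maxn _ _.
have leB : [/\ Binf <= B, k0 <= B & B1 <= B]%N.
  by rewrite /B !leq_max !leqnn !orbT.
have {leB} [leBi leBk leB1] := leB.
have Ucons : U (cons (u ord0) (fun i => u (lift ord0 i))).
  apply: Umono Uu => i; rewrite /cons; by case: unliftP => [i'|] ->.
have le_min (w : nat) C D : (C <= D)%N -> (minn w C <= minn w D)%N.
  by move=> CD; rewrite leq_min geq_minl (leq_trans (geq_minr _ _)).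
case: (ltnP (u ord0) k0.+1) => [lek|ltk].
  apply: Umono (HB1 (Ordinal lek) _ Ucons) => /=.
  apply: (le_cons _ (u ord0)) => //; last by move=> i; apply: le_min.
  by rewrite leq_min leqnn (leq_trans _ leBk).
pose v : {ffun 'I_n -> 'I_Binf.+1} := [ffun i => inord (minn (u (lift ord0 i)) Binf)].
have vE i : v i = minn (u (lift ord0 i)) Binf :> nat.
  by rewrite ffunE inordK // ltnS geq_minr.
apply: Umono (Hk0 v _).
  apply: (le_cons _ k0) => // [|i]; last by rewrite vE le_min.
  by rewrite leq_min leBk ltnW.
have [k Uk] := HBinf _ (ex_intro _ _ Ucons).
by exists k; apply: cons_mono Uk => // i; rewrite vE.
Qed.

(** Fredholm alternative. Rows of [M] outside [J] are zero, and the columns of its cokernel matrix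
    are forms vanishing on the row space; one that is nonzero at [z] is rescaled. *)
Lemma span_or_separate (F : fieldType) n d (a : 'I_n -> 'I_d -> F)
    (J : pred 'I_n) (z : 'I_d -> F) :
  (exists t : 'I_n -> F, (forall k, ~~ J k -> t k = 0) /\
     forall i, z i = \sum_k t k * a k i) \/
  (exists w : 'I_d -> F, (forall k, J k -> \sum_i w i * a k i = 0) /\
     \sum_i w i * z i = 1).
Proof.
pose M : 'M[F]_(n, d) := \matrix_(k, i) (a k i *+ J k).
pose zr : 'rV[F]_d := \row_i z i.
case: (boolP (zr <= M)%MS) => [/submxP [D zD]|nsub]; [left | right].
  exists (fun k => D 0 k *+ J k); split => [k /negbTE -> //|i].
  have /rowP/(_ i) := zD; rewrite !mxE => ->; apply: eq_bigr => k _.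
  by rewrite !mxE mulrnAr mulrnAl.
move: nsub; rewrite submxE => /eqP/rowP H.
have [l Hl] : exists l, (zr *m cokermx M) 0 l != 0.
  case: (pickP (fun l => (zr *m cokermx M) 0 l != 0)) => [l Hl|H0]; first by exists l.
  by case: H => l; have /negbFE/eqP -> := H0 l; rewrite mxE.
set s := (zr *m cokermx M) 0 l in Hl.
exists (fun i => s^-1 * cokermx M i l); split => [k Jk|].
  have /matrixP/(_ k l) := mulmx_coker M; rewrite !mxE => E.
  transitivity (s^-1 * \sum_j M k j * cokermx M j l); last by rewrite E mulr0.
  rewrite mulr_sumr; apply: eq_bigr => i _.
  have -> : M k i = a k i by rewrite mxE Jk.
  by rewrite -mulrA (mulrC (a k i)).
transitivity (s^-1 * \sum_i zr 0 i * cokermx M i l).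
  rewrite mulr_sumr; apply: eq_bigr => i _.
  have -> : zr 0 i = z i by rewrite mxE.
  by rewrite -mulrA (mulrC (z i)).
by have := mulVf Hl; rewrite {2}/s mxE.
Qed.

(** The restriction to the line is a univariate polynomial with infinitely many roots, as the
    natural numbers are distinct in [F]. *)
Lemma meval_line_nat (F : numDomainType) d (f : {mpoly F[d]}) (z a : 'I_d -> F) :
  (forall s : nat, f.@[fun i => z i + s%:R * a i] = 0) ->
  forall s, f.@[fun i => z i + s * a i] = 0.
Proof.
pose q : {poly F} := mmap (@polyC F) (fun i => (z i)%:P + (a i)%:P * 'X) f.
have qE s : q.[s] = f.@[fun i => z i + s * a i].
  rewrite /q /mmap mevalE horner_sum; apply: eq_bigr => m _.
  rewrite hornerM hornerC /mmap1 horner_prod; congr (_ * _).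
  by apply: eq_bigr => i _; rewrite !hornerE mulrC.
move=> H s; rewrite -qE; case: (eqVneq q 0) => [->|q0]; first by rewrite horner0.
pose rs := [seq (k%:R : F) | k <- iota 0 (size q)].
have rs_root : all (root q) rs.
  by apply/allP => _ /mapP [k _ ->]; rewrite rootE qE H.
have rs_uniq : uniq rs.
  by rewrite map_inj_uniq ?iota_uniq // => k l /eqP; rewrite eqr_nat => /eqP.
by have := max_poly_roots q0 rs_root rs_uniq; rewrite size_map size_iota ltnn.
Qed.

Lemma meval_eq_arg (F : comNzRingType) d (f : {mpoly F[d]}) (x y : 'I_d -> F) :
  x =1 y -> f.@[x] = f.@[y].
Proof.
move=> xy; rewrite !mevalE; apply: eq_bigr => m _; congr (_ * _).
by apply: eq_bigr => i _; rewrite xy.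
Qed.

(** Zariski density of the natural combinations. Coordinates are released one at a time: in [step m]
    the first [m] are arbitrary and the others still natural. *)
Lemma meval_span_nat (F : numDomainType) n d (f : {mpoly F[d]})
    (a : 'I_n -> 'I_d -> F) (J : pred 'I_n) (z : 'I_d -> F) :
  (forall t : 'I_n -> nat, (forall k, ~~ J k -> t k = 0%N) ->
     f.@[fun i => z i + \sum_k (t k)%:R * a k i] = 0) ->
  forall t : 'I_n -> F, (forall k, ~~ J k -> t k = 0) ->
     f.@[fun i => z i + \sum_k t k * a k i] = 0.
Proof.
move=> H.
have step m : (m <= n)%N -> forall t : 'I_n -> F, (forall k, ~~ J k -> t k = 0) ->
    (forall k : 'I_n, (m <= k)%N -> exists s : nat, t k = s%:R) ->
    f.@[fun i => z i + \sum_k t k * a k i] = 0.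
  elim: m => [_ t Jt nat_t|m IHm lt_mn t Jt nat_t].
    have [s Es] := fin_all_exists (fun k => nat_t k (leq0n k)).
    apply: etrans (H s _) => [|k /Jt /eqP]; last by rewrite Es pnatr_eq0 => /eqP.
    by apply: meval_eq_arg => i; under eq_bigr => k _ do rewrite Es.
  pose k0 : 'I_n := Ordinal lt_mn.
  pose t' s k := if k == k0 then s else t k.
  have split_sum s i : \sum_k t' s k * a k i
      = \sum_(k | k != k0) t k * a k i + s * a k0 i.
    rewrite (bigD1 k0) //= /t' eqxx addrC; congr (_ + _).
    by apply: eq_bigr => k /negbTE ->.
  case: (boolP (J k0)) => Jk0; last first.
    apply: IHm => //; first exact: ltnW.
    move=> k; rewrite leq_eqVlt => /predU1P [mk|]; last exact: nat_t.
    exists 0%N; apply: Jt; suff -> : k = k0 by [].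
    exact: val_inj.
  rewrite (@meval_eq_arg _ _ _ _
    (fun i => (z i + \sum_(k | k != k0) t k * a k i) + t k0 * a k0 i)); last first.
    by move=> i; rewrite (bigD1 k0) //= addrA addrAC.
  apply: meval_line_nat => s; rewrite (@meval_eq_arg _ _ _ _
    (fun i => z i + \sum_k t' s%:R k * a k i)); last first.
    by move=> i; rewrite split_sum addrA.
  apply: IHm; first exact: ltnW.
    by move=> k nJk; rewrite /t'; case: eqP => [E|_]; [rewrite E Jk0 in nJk | exact: Jt].
  move=> k mk; rewrite /t'; case: eqP => [_|/eqP E]; first by exists s.
  apply: nat_t; rewrite ltn_neqAle mk andbT; apply: contraNneq E => E.
  by apply/eqP; apply: val_inj.
by move=> t Jt; apply: (step n) => // k; rewrite leqNgt ltn_ord.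
Qed.

(** * Koszul complexes *)

Section Koszul.
Variables (F : comNzRingType) (V : lmodType F) (d : nat).
Implicit Types (c : {set 'I_d} -> V) (tau : {set 'I_d}).

Definition ksign (i : 'I_d) tau : F := (-1) ^+ #|[set l in tau | (l < i)%N]|.

Lemma ksignU i l tau : l \notin tau ->
  ksign i (l |: tau) = (-1) ^+ (l < i)%N * ksign i tau.
Proof.
move=> ltau; rewrite /ksign -exprD; congr (_ ^+ _).
case: ltnP => li.
  have -> : [set m in l |: tau | (m < i)%N] = l |: [set m in tau | (m < i)%N].
    by apply/setP => m; rewrite !inE andb_orl; case: eqP => [->|//]; rewrite li.
  by rewrite cardsU1 inE (negbTE ltau).
rewrite add0n; congr #|pred_of_set _|; apply/setP => m; rewrite !inE andb_orl.
by case: eqP => [->|//]; rewrite ltnNge li.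
Qed.

Lemma ksignD1 i tau : ksign i (tau :\ i) = ksign i tau.
Proof.
rewrite /ksign; congr (_ ^+ #|pred_of_set _|); apply/setP => m; rewrite !inE.
by case: eqP => [->|//]; rewrite ltnn !andbF.
Qed.

Lemma ksign_sqr i tau : ksign i tau * ksign i tau = 1.
Proof. by rewrite /ksign -exprD addnn -muln2 exprM sqrr_sign. Qed.

Variables (phi h : 'I_d -> {linear V -> V}).

Definition koszul_diff c tau : V :=
  \sum_(i < d | i \notin tau) ksign i tau *: phi i (c (i |: tau)).

Definition koszul_wedge c tau : V :=
  \sum_(i < d | i \in tau) ksign i tau *: h i (c (tau :\ i)).

Hypothesis phi_h : forall i l v, phi i (h l v) = h l (phi i v).

(** Cartan's formula for contraction and wedge. The diagonal terms of the first composite give the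
    indices outside [tau], those of the second the indices in [tau]. *)
Lemma koszul_homotopy c tau :
  koszul_diff (koszul_wedge c) tau + koszul_wedge (koszul_diff c) tau
    = \sum_(i < d) phi i (h i (c tau)).
Proof.
rewrite /koszul_diff /koszul_wedge.
rewrite (bigID (mem tau) predT) /=.
have -> : \sum_(i in tau) ksign i tau *: h i
     (\sum_(l | l \notin tau :\ i) ksign l (tau :\ i) *: phi l (c (l |: tau :\ i)))
  = \sum_(i in tau) phi i (h i (c tau))
    + \sum_(i in tau) \sum_(l | l \notin tau) (ksign i tau * ksign l (tau :\ i)) *:
        phi l (h i (c (l |: tau :\ i))).
  rewrite -big_split; apply: eq_bigr => i itau /=.
  rewrite linear_sum scaler_sumr (bigD1 i) /=; last by rewrite !inE eqxx.
  rewrite linearZ /= scalerA ksignD1 ksign_sqr scale1r setD1K // phi_h; congr (_ + _).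
  apply: eq_big => [l|l _]; last by rewrite linearZ /= scalerA phi_h.
  by rewrite !inE negb_and negbK; case: eqP => [->|_]; rewrite ?itau ?andbT.
rewrite addrCA; congr (_ + _).
have -> : \sum_(i | i \notin tau) ksign i tau *: phi i
     (\sum_(l in i |: tau) ksign l (i |: tau) *: h l (c ((i |: tau) :\ l)))
  = \sum_(i | i \notin tau) phi i (h i (c tau))
    + \sum_(i | i \notin tau) \sum_(l in tau) (ksign i tau * ksign l (i |: tau)) *:
        phi i (h l (c (i |: tau :\ l))).
  rewrite -big_split; apply: eq_bigr => i itau /=.
  rewrite linear_sum scaler_sumr (bigD1 i) /=; last by rewrite !inE eqxx.
  rewrite linearZ /= scalerA -(ksignD1 i (i |: tau)) setU1K // ksign_sqr scale1r; congr (_ + _).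
  apply: eq_big => [l|l /andP [_ li]].
    by rewrite !inE; case: eqP => [->|_]; rewrite ?(negbTE itau) ?andbF ?andbT.
  rewrite linearZ /= scalerA; congr (_ *: phi i (h l (c _))).
  by apply/setP => m; rewrite !inE; case: (eqVneq m i) => [->|//]; rewrite eq_sym li.
(* Off the diagonal both composites produce the same vectors; adding [i] and removing [l] in the
   other order changes the sign, so they cancel. *)
rewrite -addrA [X in _ + X = _](_ : _ = 0) ?addr0 //.
rewrite exchange_big -big_split /=; apply: big1 => i itau.
rewrite -big_split /=; apply: big1 => l ltau.
rewrite -scalerDl ksignU //.
have li : l != i by apply: contraNneq ltau => ->.
have -> : ksign l tau = (-1) ^+ (i < l)%N * ksign l (tau :\ i).
  by rewrite -ksignU ?setD1K // !inE eqxx.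
have -> : (-1) ^+ (l < i)%N = - (-1) ^+ (i < l)%N :> F.
  have := li; rewrite -val_eqE /=; case: ltngtP => //= _ _; by rewrite ?opprK.
set s := (-1) ^+ _; have ss : s * s = 1 by rewrite /s -exprD addnn -muln2 exprM sqrr_sign.
rewrite (_ : _ + _ = (1 - s * s) * (ksign i tau * ksign l (tau :\ i))); last by ring.
by rewrite ss subrr mul0r scale0r.
Qed.

End Koszul.

(** * A quasi-isomorphism criterion for Koszul complexes modulo a submodule *)

Section KoszulQuasiIso.
Variables (F : comNzRingType) (V : lmodType F) (d : nat).
Variables (phi : 'I_d -> {linear V -> V}) (delta : {linear V -> V}).
Variable N : V -> Prop.
Hypothesis N0 : N 0.
Hypothesis NB : forall u v, N u -> N v -> N (u - v).
Hypothesis NZ : forall (a : F) v, N v -> N (a *: v).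
Hypothesis N_phi : forall i v, N v -> N (phi i v).
Hypothesis delta_phi : forall i v, delta (phi i v) = phi i (delta v).
Hypothesis N_delta_inj : forall v, N (delta v) -> N v.
(** [N] plays the role of zero, so no quotient is formed. [T] is homotopic to the identity through
    [koszul_wedge h] and may depend on the chain whose coefficients it moves into the image of
    [delta]. *)
Hypothesis killed : forall c : {set 'I_d} -> V,
  exists (T : {linear V -> V}) (h : 'I_d -> {linear V -> V}),
  [/\ forall i v, T (phi i v) = phi i (T v),
      forall v, T (delta v) = delta (T v) &
      forall v, N v -> N (T v)] /\
  [/\ forall v, T v = v + \sum_i phi i (h i v),
      forall i l v, phi i (h l v) = h l (phi i v),
      forall i v, N v -> N (h i v) &
      forall sigma, exists y, N (T (c sigma) - delta y)].

Let NN v : N v -> N (- v).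
Proof. by rewrite -[- v]sub0r; apply: NB. Qed.

Let ND u v : N u -> N v -> N (u + v).
Proof. by move=> Nu Nv; rewrite -[v]opprK; apply/NB/NN. Qed.

Let Nsum (P : pred 'I_d) (f : 'I_d -> V) :
  (forall i, P i -> N (f i)) -> N (\sum_(i | P i) f i).
Proof. by move=> Nf; elim/big_rec: _ => // i v Pi; apply/ND/Nf. Qed.

Let diffN c (tau : {set 'I_d}) :
  (forall sigma : {set 'I_d}, #|sigma| = #|tau|.+1 -> N (c sigma)) ->
  N (koszul_diff phi c tau).
Proof.
by move=> Nc; apply: Nsum => i itau; apply/NZ/N_phi/Nc; rewrite cardsU1 itau.
Qed.

Let diffB b c tau : koszul_diff phi (fun s => b s - c s) tau
  = koszul_diff phi b tau - koszul_diff phi c tau.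
Proof. by rewrite -sumrB; apply: eq_bigr => i _; rewrite linearB scalerBr. Qed.

Let diff_comm (f : {linear V -> V}) c tau :
  (forall i v, f (phi i v) = phi i (f v)) ->
  f (koszul_diff phi c tau) = koszul_diff phi (fun s => f (c s)) tau.
Proof.
by move=> fphi; rewrite linear_sum; apply: eq_bigr => i _; rewrite linearZ fphi.
Qed.

Let wedgeN (h : 'I_d -> {linear V -> V}) k c (sigma : {set 'I_d}) :
  (forall i v, N v -> N (h i v)) ->
  (forall tau : {set 'I_d}, #|tau|.+1 = k -> N (c tau)) -> #|sigma| = k ->
  N (koszul_wedge h c sigma).
Proof.
move=> N_h Nc sk; apply: Nsum => i isigma; apply/NZ/N_h/Nc.
by rewrite -sk (cardsD1 i sigma) isigma.
Qed.

(** Modulo [N], [T c = delta y], and [y] is a cycle because [delta] is injective and commutes with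
    the differential. By the homotopy formula [T c - c] is a boundary. *)
Lemma koszul_mul_surjective k c :
  (forall tau : {set 'I_d}, #|tau|.+1 = k -> N (koszul_diff phi c tau)) ->
  exists2 c', forall tau : {set 'I_d}, #|tau|.+1 = k -> N (koszul_diff phi c' tau) &
    exists b, forall sigma : {set 'I_d}, #|sigma| = k ->
      N (delta (c' sigma) - c sigma - koszul_diff phi b sigma).
Proof.
move=> cyc; have [T [h [[T_phi T_delta N_T] [TE phi_h N_h]]]] := killed c.
move=> /fin_all_exists [y Ny]; exists y => [tau tk|].
  apply: N_delta_inj; rewrite diff_comm //.
  have NTd : N (T (koszul_diff phi c tau)) by apply/N_T/cyc.
  rewrite -[X in N X](subKr (T (koszul_diff phi c tau))); apply: NB => //.
  by rewrite (diff_comm c) // -diffB; apply: diffN => sigma _; apply: Ny.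
exists (koszul_wedge h c) => sigma sk.
have -> : koszul_diff phi (koszul_wedge h c) sigma
    = T (c sigma) - c sigma - koszul_wedge h (koszul_diff phi c) sigma.
  by rewrite TE (addrC (c sigma)) addrK -koszul_homotopy // addrK.
rewrite opprB.
have -> : delta (y sigma) - c sigma + (koszul_wedge h (koszul_diff phi c) sigma
    - (T (c sigma) - c sigma))
  = koszul_wedge h (koszul_diff phi c) sigma - (T (c sigma) - delta (y sigma)).
  by rewrite !opprB addrCA; congr (_ + _); rewrite addrA subrK.
by apply: NB => //; apply: wedgeN sk.
Qed.

(** Here [killed] is applied to the bounding chain: if [T b = delta y], then [delta] agrees on [T c]
    and on the differential of [y], hence [T c] bounds, and the homotopy formula passes this on to
    [c]. *)
Lemma koszul_mul_injective k c :
  (forall tau : {set 'I_d}, #|tau|.+1 = k -> N (koszul_diff phi c tau)) ->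
  (exists b, forall sigma : {set 'I_d}, #|sigma| = k ->
     N (delta (c sigma) - koszul_diff phi b sigma)) ->
  exists b, forall sigma : {set 'I_d}, #|sigma| = k ->
     N (c sigma - koszul_diff phi b sigma).
Proof.
move=> cyc [b Nb]; have [T [h [[T_phi T_delta N_T] [TE phi_h N_h]]]] := killed b.
move=> /fin_all_exists [y Ny].
exists (fun s => y s - koszul_wedge h c s) => sigma sk.
have NTc : N (T (c sigma) - koszul_diff phi y sigma).
  apply: N_delta_inj; rewrite linearB /= -T_delta diff_comm //.
  rewrite -[X in N (X - _)](subrK (T (koszul_diff phi b sigma))) -addrA.
  apply: ND; first by rewrite -linearB; apply/N_T/Nb.
  by rewrite (diff_comm b) // -diffB; apply: diffN => s _; apply: Ny.
rewrite diffB.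
have -> : koszul_diff phi (koszul_wedge h c) sigma
    = T (c sigma) - c sigma - koszul_wedge h (koszul_diff phi c) sigma.
  by rewrite TE (addrC (c sigma)) addrK -koszul_homotopy // addrK.
have Nw : N (koszul_wedge h (koszul_diff phi c) sigma) by apply: wedgeN sk.
move: (koszul_wedge _ _ _) (koszul_diff _ _ _) NTc Nw => u v NTc Nu.
have -> : c sigma - (v - (T (c sigma) - c sigma - u)) = T (c sigma) - v - u.
  by rewrite opprB addrC [_ - v + _]addrAC (addrAC (_ - _) (- u)) subrK addrAC.
exact: NB.
Qed.

End KoszulQuasiIso.

(** * The Weyl algebra in normal order *)

Section LinearExtension.
Variables (R : comNzRingType) (n : nat) (V : lmodType R) (w : 'X_{1..n} -> V).

(** Summation over [msupp] makes [embR] an instance by conversion. *)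
Definition lext (p : {mpoly R[n]}) : V := \sum_(m <- msupp p) p@_m *: w m.

Lemma lextE p k : (msize p <= k)%N -> lext p = \sum_(m : 'X_{1..n < k}) p@_m *: w m.
Proof.
move=> le_pk; pose I : subFinType _ := 'X_{1..n < k}.
rewrite /lext (big_mksub I) ?msupp_uniq //=; first last.
  by move=> x /msize_mdeg_lt /leq_trans; apply.
by rewrite big_rmcond //= => m; move/memN_msupp_eq0 ->; rewrite scale0r.
Qed.

Lemma lext_is_linear : linear lext.
Proof.
move=> a p q; pose k := maxn (msize (a *: p + q)) (maxn (msize p) (msize q)).
rewrite !(@lextE _ k) /k ?leq_max ?leqnn ?orbT // scaler_sumr -big_split.
by apply: eq_bigr => m _ /=; rewrite linearP scalerDl scalerA.
Qed.

HB.instance Definition _ :=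
  GRing.isLinear.Build R {mpoly R[n]} V *:%R lext lext_is_linear.

Lemma lextX m : lext 'X_[m] = w m.
Proof. by rewrite /lext msuppX big_seq1 mcoeffX eqxx scale1r. Qed.

End LinearExtension.

Lemma mpoly_lin_ext (R : comNzRingType) n (V : lmodType R)
    (f g : {linear {mpoly R[n]} -> V}) :
  (forall m, f 'X_[m] = g 'X_[m]) -> forall p, f p = g p.
Proof.
move=> fg p; rewrite [p]mpolyE !linear_sum; apply: eq_bigr => m _.
by rewrite !linearZ fg.
Qed.

Lemma mpoly_lin_ind (R : comNzRingType) n (P : {mpoly R[n]} -> Prop) :
  P 0 -> (forall p q, P p -> P q -> P (p + q)) -> (forall a p, P p -> P (a *: p)) ->
  (forall m, P 'X_[m]) -> forall p, P p.
Proof.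
move=> P0 PD PZ PX p; rewrite [p]mpolyE; elim/big_ind: _ => // m _; exact: PZ.
Qed.

Section Exponents.
Variable n : nat.
Implicit Types (al : 'X_{1..n}) (m : 'X_{1..n + n}) (k : 'I_n).

Definition xexp m : 'X_{1..n} := [multinom m (xv k) | k < n].
Definition dexp m : 'X_{1..n} := [multinom m (dv k) | k < n].

Lemma split_xv k : split (xv k) = inl k.
Proof. exact: (unsplitK (inl k)). Qed.

Lemma split_dv k : split (dv k) = inr k.
Proof. exact: (unsplitK (inr k)). Qed.

Lemma xpart_x al k : xpart al (xv k) = al k.
Proof. by rewrite mnmE split_xv. Qed.

Lemma xpart_d al k : xpart al (dv k) = 0%N.
Proof. by rewrite mnmE split_dv. Qed.

Lemma dpart_x al k : dpart al (xv k) = 0%N.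
Proof. by rewrite mnmE split_xv. Qed.

Lemma dpart_d al k : dpart al (dv k) = al k.
Proof. by rewrite mnmE split_dv. Qed.

Lemma xvdv_ind (P : 'I_(n + n) -> Prop) :
  (forall k, P (xv k)) -> (forall k, P (dv k)) -> forall i, P i.
Proof.
by move=> Px Pd i; rewrite -(splitK i); case: (split i) => k; [apply: Px|apply: Pd].
Qed.

Lemma xv_eq k l : (xv k == xv l) = (k == l).
Proof. exact: (inj_eq (@lshift_inj _ _)). Qed.

Lemma dv_eq k l : (dv k == dv l) = (k == l).
Proof. exact: (inj_eq (@rshift_inj _ _)). Qed.

Lemma xv_dv k l : (xv k == dv l) = false.
Proof. exact: eq_lrshift. Qed.

Lemma dv_xv k l : (dv k == xv l) = false.
Proof. exact: eq_rlshift. Qed.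

Lemma expE m : m = (xpart (xexp m) + dpart (dexp m))%MM.
Proof.
apply/mnmP; apply: xvdv_ind => k; rewrite mnmDE.
  by rewrite xpart_x dpart_x mnmE addn0.
by rewrite xpart_d dpart_d mnmE.
Qed.

Lemma dpart0 : dpart (0 : 'X_{1..n}) = 0%MM.
Proof. by apply/mnmP; apply: xvdv_ind => k; rewrite ?dpart_x ?dpart_d !mnmE. Qed.

Lemma xpart0 : xpart (0 : 'X_{1..n}) = 0%MM.
Proof. by apply/mnmP; apply: xvdv_ind => k; rewrite ?xpart_x ?xpart_d !mnmE. Qed.

Lemma dpart1 k : dpart U_(k) = U_(dv k)%MM.
Proof.
by apply/mnmP; apply: xvdv_ind => l; rewrite ?dpart_x ?dpart_d !mnm1E ?dv_xv ?dv_eq.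
Qed.

Lemma xpart1 k : xpart U_(k) = U_(xv k)%MM.
Proof.
by apply/mnmP; apply: xvdv_ind => l; rewrite ?xpart_x ?xpart_d !mnm1E ?xv_dv ?xv_eq.
Qed.

Lemma xexpE m k : xexp m k = m (xv k). Proof. exact: mnmE. Qed.
Lemma dexpE m k : dexp m k = m (dv k). Proof. exact: mnmE. Qed.

Lemma xexpD m m' : xexp (m + m') = (xexp m + xexp m')%MM.
Proof. by apply/mnmP => k; rewrite mnmDE !mnmE. Qed.

Lemma dexpD m m' : dexp (m + m') = (dexp m + dexp m')%MM.
Proof. by apply/mnmP => k; rewrite mnmDE !mnmE. Qed.

Lemma xexp_dpart al : xexp (dpart al) = 0%MM.
Proof. by apply/mnmP => k; rewrite xexpE dpart_x mnmE. Qed.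

Lemma dexp_dpart al : dexp (dpart al) = al.
Proof. by apply/mnmP => k; rewrite dexpE dpart_d. Qed.

Lemma xexp_xpart al : xexp (xpart al) = al.
Proof. by apply/mnmP => k; rewrite xexpE xpart_x. Qed.

Lemma dexp_xpart al : dexp (xpart al) = 0%MM.
Proof. by apply/mnmP => k; rewrite dexpE xpart_d mnmE. Qed.

End Exponents.

Lemma mderivm_monomial_eq0 (R : comNzRingType) n (m al : 'X_{1..n}) i :
  (m i < al i)%N -> ('X_[R, m])^`M[al] = 0.
Proof.
move=> lt_i; rewrite mderivmX (bigD1 i) //= ffact_small //.
by rewrite mul0n scale0r.
Qed.

Lemma mderiv_var (R : comNzRingType) n (i k : 'I_n) :
  ('X_k : {mpoly R[n]})^`M(i) = (i == k)%:R.
Proof.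
rewrite mderivX mnm1E eq_sym; case: eqP => [->|_]; last by rewrite scale0r.
by rewrite -{1}[U_(k)%MM]add0m addmK mpolyX0 scale1r.
Qed.

(** * The Leibniz product of normally ordered symbols *)

Section WeylProduct.
Variable n : nat.
Local Notation D := {mpoly CC[n + n]}.
Implicit Types (P Q : D).

Definition weyl_term P Q (al : 'X_{1..n}) : D :=
  ((\prod_(k < n) (al k)`!)%:R)^-1 *: (P^`M[dpart al] * Q^`M[xpart al]).

(** Each monomial of [P] has degree below [mdeg al], hence some d-exponent below the matching entry
    of [al]. This lets the cutoff in [weyl_mul] be raised. *)
Lemma weyl_term_eq0 P Q al : (msize P <= mdeg al)%N -> weyl_term P Q al = 0.
Proof.
move=> leP; rewrite /weyl_term [P^`M[_]](_ : _ = 0) ?mul0r ?scaler0 //.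
rewrite [P in P^`M[_]]mpolyE linear_sum big_seq big1 // => m /msize_mdeg_lt ltm.
rewrite linearZ /=.
have [i lti] : exists i, (m (dv i) < al i)%N.
  apply/existsP; apply: contraLR (leq_trans ltm leP).
  rewrite negb_exists -leqNgt => /forallP le_al.
  rewrite !mdegE big_split_ord /= (leq_trans _ (leq_addl _ _)) //.
  by apply: leq_sum => i _; rewrite leqNgt le_al.
by rewrite (@mderivm_monomial_eq0 _ _ _ _ (dv i)) ?scaler0 // dpart_d.
Qed.

Lemma weyl_mulE k P Q : (msize P <= k)%N ->
  weyl_mul P Q = \sum_(al : 'X_{1..n < k}) weyl_term P Q (val al).
Proof.
move=> le_k; pose I : subFinType _ := 'X_{1..n < k}.
pose J : subFinType _ := 'X_{1..n < msize P}.
rewrite /weyl_mul -/(weyl_term P Q _).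
have le_JI (al : 'X_{1..n}) : (mdeg al < msize P)%N -> (mdeg al < k)%N.
  by move/leq_trans; apply.
rewrite [LHS](big_sub_widen J I xpredT (weyl_term P Q) le_JI) /=.
rewrite [RHS](bigID (fun al : 'X_{1..n < k} => (mdeg al < msize P)%N)) /=.
by rewrite [X in _ + X]big1 ?addr0 // => al; rewrite -leqNgt; apply: weyl_term_eq0.
Qed.

(** Any [al] other than 0 and [U_(k)] differentiates ['X_[m]] to zero. The cutoff [K] stays free
    because d_k and the Euler operators are expanded under different bounds. *)
Lemma weyl_mul_dX (k : 'I_n) m Q : dexp m = U_(k)%MM -> forall K, (1 < K)%N ->
  \sum_(al : 'X_{1..n < K}) weyl_term 'X_[m] Q (val al)
    = 'X_[m] * Q + 'X_[m - U_(dv k)] * Q^`M(xv k).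
Proof.
move=> mk K K1; have mE i : m (dv i) = (k == i) by rewrite -dexpE mk mnm1E.
have K0 : (mdeg (0%MM : 'X_{1..n}) < K)%N by rewrite mdeg0 ltnW.
have Kk : (mdeg (U_(k)%MM : 'X_{1..n}) < K)%N by rewrite mdeg1.
have neq : BMultinom Kk != BMultinom K0 by rewrite -val_eqE /= mnm1_eq0.
rewrite (bigD1 (BMultinom K0)) //= (bigD1 (BMultinom Kk)) //= big1 ?addr0.
  rewrite /weyl_term dpart0 xpart0 !mderivm0m dpart1 xpart1 !mderivmU1m mderivX mE eqxx.
  rewrite !big1 ?invr1 ?scale1r // => i _; first by rewrite mnm1E; case: eqP.
  by rewrite mnm0E.
move=> al /andP [al0 alk]; rewrite /weyl_term.
suff [i lti] : exists i, (m (dv i) < val al i)%N.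
  by rewrite (@mderivm_monomial_eq0 _ _ _ _ (dv i)) ?mul0r ?scaler0 // dpart_d.
apply/existsP; apply: contraR alk; rewrite negb_exists => /forallP le_al.
have {le_al} le_al i : (val al i <= (k == i))%N by rewrite -mE leqNgt le_al.
have al_i i : i != k -> val al i = 0%N.
  by move=> ik; have := le_al i; rewrite eq_sym (negbTE ik) leqn0 => /eqP.
have : (0 < val al k)%N.
  rewrite lt0n; apply: contraNneq al0 => alk; rewrite -val_eqE /=.
  by apply/eqP/mnmP => i; rewrite mnm0E; case: (eqVneq i k) => [->|/al_i].
have := le_al k; rewrite eqxx => le1 gt0; rewrite -val_eqE /=; apply/eqP/mnmP => i.
rewrite mnm1E; case: (eqVneq k i) => [<-|ki]; last by rewrite al_i // eq_sym.
by apply/eqP; rewrite eqn_leq le1.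
Qed.

Lemma weyl_mul_d (k : 'I_n) Q :
  weyl_mul 'X_(dv k) Q = 'X_(dv k) * Q + Q^`M(xv k).
Proof.
rewrite (@weyl_mulE 2) ?msizeX ?mdeg1 // (@weyl_mul_dX k) //.
  by rewrite -{2}[U_(dv k)%MM]add0m addmK mpolyX0 mul1r.
by rewrite -dpart1 dexp_dpart.
Qed.

Lemma weyl_mul_Euler d (A : 'M[int]_(d, n)) i Q :
  weyl_mul (Euler A i) Q = \sum_k (A i k)%:~R *:
    ('X_(xv k) * 'X_(dv k) * Q + 'X_(xv k) * Q^`M(xv k)).
Proof.
rewrite (@weyl_mulE 3); last first.
  rewrite /Euler; apply: leq_trans (msize_sum _ _ _) _; apply/bigmax_leqP => k _.
  by apply: leq_trans (msizeZ_le _ _) _; rewrite msizeX mdegD !mdeg1.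
have termE al : weyl_term (Euler A i) Q al
    = \sum_k (A i k)%:~R *: weyl_term 'X_[U_(xv k) + U_(dv k)] Q al.
  rewrite /weyl_term /Euler linear_sum mulr_suml scaler_sumr.
  by apply: eq_bigr => k _; rewrite linearZ -scalerAl !scalerA mulrC.
under eq_bigr => al _ do rewrite termE.
rewrite exchange_big; apply: eq_bigr => k _; rewrite -scaler_sumr; congr (_ *: _).
rewrite (@weyl_mul_dX k) // ?addmK ?mpolyXD //.
by rewrite dexpD -dpart1 -xpart1 dexp_dpart dexp_xpart add0m.
Qed.

Lemma embR_linear : linear (@embR n).
Proof. exact: lext_is_linear. Qed.

HB.instance Definition _ :=
  GRing.isLinear.Build CC {mpoly CC[n]} {mpoly CC[n + n]} *:%R (@embR n) embR_linear.

Lemma embRX (u : 'X_{1..n}) : embR 'X_[u] = 'X_[dpart u].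
Proof. exact: lextX. Qed.

(** [embR q] contains no x, so only [al = 0] survives. Membership in D_A I_A can thus be studied
    with the commutative product. *)
Lemma weyl_mul_embR P q : weyl_mul P (embR q) = P * embR q.
Proof.
rewrite (@weyl_mulE (msize P).+1) //.
have K0 : (mdeg (0%MM : 'X_{1..n}) < (msize P).+1)%N by rewrite mdeg0.
rewrite (bigD1 (BMultinom K0)) //= big1 ?addr0.
  rewrite /weyl_term dpart0 xpart0 !mderivm0m big1 ?invr1 ?scale1r // => i _.
  by rewrite mnm0E.
move=> al al0; rewrite /weyl_term [X in _ * X](_ : _ = 0) ?mulr0 ?scaler0 //.
have [i lti] : exists i, (0 < val al i)%N.
  apply/existsP; apply: contraR al0; rewrite negb_exists => /forallP al0.
  rewrite -val_eqE /=; apply/eqP/mnmP => i; rewrite mnm0E; apply/eqP.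
  by rewrite -leqn0 leqNgt al0.
elim/mpoly_lin_ind: q => [|p q Hp Hq|a p Hp|u].
- by rewrite !linear0.
- by rewrite !linearD /= Hp Hq addr0.
- by rewrite !linearZ /= Hp scaler0.
by rewrite embRX (@mderivm_monomial_eq0 _ _ _ _ (xv i)) // xpart_x dpart_x.
Qed.

End WeylProduct.

Lemma mulX_mderiv (R : comNzRingType) n (m : 'X_{1..n}) (k : 'I_n) :
  'X_k * ('X_[m])^`M(k) = (m k)%:R *: 'X_[R, m].
Proof.
rewrite mderivX -scalerAr -mpolyXD addmC.
case: (posnP (m k)) => [->|mk]; first by rewrite !scale0r.
by rewrite submK // lep1mP -lt0n.
Qed.

Section Degrees.
Variables (d n : nat) (A : 'M[int]_(d, n)).

(** The exponent of t in C[x][NA]; its sign is opposite to that of [degR]. *)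
Definition Adeg (u : 'X_{1..n}) : 'cV[int]_d := \sum_k col k A *+ u k.

Lemma AdegD u v : Adeg (u + v) = Adeg u + Adeg v.
Proof. by rewrite -big_split; apply: eq_bigr => k _; rewrite mnmDE mulrnDr. Qed.

Lemma Adeg1 k : Adeg U_(k) = col k A.
Proof.
rewrite /Adeg (bigD1 k) //= mnm1E eqxx mulr1n big1 ?addr0 // => l lk.
by rewrite mnm1E eq_sym (negbTE lk).
Qed.

Lemma AdegE u i : Adeg u i 0 = Amul A (fun k => (u k)%:Z) i.
Proof.
by rewrite summxE; apply: eq_bigr => k _; rewrite mulmxnE mxE -mulr_natr natz.
Qed.

Lemma Adeg_upos (u : 'I_n -> int) : (forall i, Amul A u i = 0) ->
  Adeg (upos u) = Adeg (upos (fun k => - u k)).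
Proof.
move=> Au; apply/matrixP => i l; rewrite ord1 !AdegE; apply/eqP.
rewrite -subr_eq0 /Amul -sumrB; apply/eqP/(etrans _ (Au i)); apply: eq_bigr => k _.
by rewrite -mulrBr !mnmE; congr (_ * _); lia.
Qed.

(** Dividing by the common factor ['X_[g]] leaves the generator attached to [e], the difference of
    [u] and [v]. *)
Lemma binomial_toric_ideal u v : Adeg u = Adeg v ->
  toric_ideal A ('X_[u] - 'X_[v]).
Proof.
move=> Auv; pose e k := (u k)%:Z - (v k)%:Z.
pose g : 'X_{1..n} := [multinom minn (u k) (v k) | k < n].
exists [:: ('X_[g], binom e)]; split => [q|].
  rewrite inE => /eqP -> /=; exists e; split => // i.
  rewrite -[RHS](subrr (Adeg u i 0)) {2}Auv !AdegE /Amul -sumrB.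
  by apply: eq_bigr => k _; rewrite -mulrBr.
rewrite big_seq1 /= /binom mulrBr -!mpolyXD; congr ('X_[_] - 'X_[_]).
  by apply/mnmP => k; rewrite mnmDE !mnmE /e; lia.
by apply/mnmP => k; rewrite mnmDE !mnmE /e; lia.
Qed.

End Degrees.

Section Ideal.
Variables (n : nat) (G : {mpoly CC[n]} -> Prop).

Lemma in_ideal0 : in_ideal G 0.
Proof. by exists [::]; rewrite big_nil. Qed.

Lemma in_idealD p q : in_ideal G p -> in_ideal G q -> in_ideal G (p + q).
Proof.
move=> [s [Gs ->]] [t [Gt ->]]; exists (s ++ t); rewrite big_cat; split=> // r.
by rewrite mem_cat => /orP [/Gs|/Gt].
Qed.

Lemma in_idealM r p : in_ideal G p -> in_ideal G (r * p).
Proof.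
move=> [s [Gs ->]]; exists [seq (r * q.1, q.2) | q <- s]; split.
  by move=> q /mapP [q' /Gs ? ->].
by rewrite big_map mulr_sumr; apply: eq_bigr => q _; rewrite mulrA.
Qed.

Lemma in_ideal_gen p : G p -> in_ideal G p.
Proof.
exists [:: (1, p)]; rewrite big_seq1 mul1r; split => // q.
by rewrite inE => /eqP ->.
Qed.

Lemma in_ideal_functional (V : lmodType CC) (f : {linear {mpoly CC[n]} -> V}) p :
  (forall g, G g -> forall m, f ('X_[m] * g) = 0) -> in_ideal G p -> f p = 0.
Proof.
move=> fG [s [Gs ->]]; rewrite linear_sum big_seq big1 // => q /Gs Gq.
elim/mpoly_lin_ind: q.1 => [|p1 p2 H1 H2|a p1 H1|m]; last exact: fG.
- by rewrite mul0r linear0.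
- by rewrite mulrDl linearD /= H1 H2 addr0.
- by rewrite -scalerAl linearZ /= H1 scaler0.
Qed.

End Ideal.

(** * Euler operators and left multiplication by d_j on symbols *)

Section Operators.
Variables (d n : nat) (A : 'M[int]_(d, n)).
Local Notation D := {mpoly CC[n + n]}.

(** Right multiplication by x_k d_k, written on normally ordered symbols. This is why these
    operators commute with each other and with left multiplication by d_j. *)
Definition eul (k : 'I_n) (P : D) : D :=
  'X_(xv k) * 'X_(dv k) * P + 'X_(dv k) * P^`M(dv k).

Lemma eul_is_linear k : linear (eul k).
Proof.
move=> a P Q; rewrite /eul linearP /= !mulrDr -!scalerAr scalerDr.
by rewrite addrACA.
Qed.

HB.instance Definition _ k := GRing.isLinear.Build CC D D *:%R (eul k) (eul_is_linear k).

Definition weyl_del (j : 'I_n) (P : D) : D := 'X_(dv j) * P + P^`M(xv j).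

Lemma weyl_del_is_linear j : linear (weyl_del j).
Proof.
by move=> a P Q; rewrite /weyl_del linearP /= mulrDr -scalerAr scalerDr addrACA.
Qed.

HB.instance Definition _ j :=
  GRing.isLinear.Build CC D D *:%R (weyl_del j) (weyl_del_is_linear j).

Lemma eulC k l P : eul k (eul l P) = eul l (eul k P).
Proof.
rewrite /eul !mderivD !mderivM !mderiv_var !dv_xv !dv_eq (mderiv_comm (dv l)).
by case: (eqVneq k l) => [-> //|_]; rewrite /= mulr0n; ring.
Qed.

Lemma weyl_del_eul j k P : weyl_del j (eul k P) = eul k (weyl_del j P).
Proof.
rewrite /eul /weyl_del !mderivD !mderivM !mderiv_var !dv_eq !xv_eq !xv_dv (mderiv_comm (dv k)).
case: (eqVneq k j) => [->|_]; rewrite /= ?mulr0n ?mulr1n; ring.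
Qed.

Lemma eulX k m :
  eul k 'X_[m] = 'X_[m + (U_(xv k) + U_(dv k))] + (m (dv k))%:R *: 'X_[m].
Proof. by rewrite /eul mulX_mderiv -!mpolyXD addmC. Qed.

Lemma weyl_delX j m :
  weyl_del j 'X_[m] = 'X_[m + U_(dv j)] + (m (xv j))%:R *: 'X_[m - U_(xv j)].
Proof. by rewrite /weyl_del mderivX -mpolyXD addmC. Qed.

Variable beta : 'I_d -> CC.

Definition twisted_euler (i : 'I_d) (P : D) : D :=
  \sum_k (A i k)%:~R *: eul k P - beta i *: P.

Lemma twisted_euler_is_linear i : linear (twisted_euler i).
Proof.
move=> a P Q; rewrite /twisted_euler scalerBr scaler_sumr addrACA -big_split scalerDr.
rewrite opprD !scalerA (mulrC a) -!scalerA; congr (_ + _).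
by apply: eq_bigr => k _; rewrite linearP /= scalerDr !scalerA mulrC.
Qed.

HB.instance Definition _ i :=
  GRing.isLinear.Build CC D D *:%R (twisted_euler i) (twisted_euler_is_linear i).

Lemma comm_twisted_euler (f : {linear D -> D}) i :
  (forall k P, f (eul k P) = eul k (f P)) ->
  forall P, f (twisted_euler i P) = twisted_euler i (f P).
Proof.
move=> fE P; rewrite linearB linear_sum linearZ; congr (_ - _).
by apply: eq_bigr => k _; rewrite linearZ /= fE.
Qed.

Lemma weyl_del_twisted_euler j i P :
  weyl_del j (twisted_euler i P) = twisted_euler i (weyl_del j P).
Proof. by apply: (@comm_twisted_euler (weyl_del j)) => k Q /=; rewrite weyl_del_eul. Qed.

Lemma twisted_eulerC i l P :
  twisted_euler i (twisted_euler l P) = twisted_euler l (twisted_euler i P).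
Proof.
apply: (@comm_twisted_euler (twisted_euler i)) => k Q /=.
by apply/esym/(@comm_twisted_euler (eul k)) => k' R /=; rewrite eulC.
Qed.

Lemma twisted_eulerX i m : twisted_euler i 'X_[m] =
  \sum_k (A i k)%:~R *: 'X_[m + (U_(xv k) + U_(dv k))]
  + ((Adeg A (dexp m) i 0)%:~R - beta i) *: 'X_[m].
Proof.
rewrite /twisted_euler scalerBl addrA; congr (_ - _).
rewrite AdegE /Amul rmorph_sum scaler_suml -big_split; apply: eq_bigr => k _.
by rewrite eulX scalerDr scalerA rmorphM /= dexpE.
Qed.

(** For homogeneous y the commutator of E_i and y is deg_i(y) y, so the Koszul endomorphism is right
    multiplication by E_i - beta_i. *)
Lemma kphiE i P : kphi A beta i P = twisted_euler i P.
Proof.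
rewrite /kphi weyl_mul_Euler.
pose w m : D := (beta i + (degD A m i)%:~R) *: 'X_[m].
have -> : \sum_(m <- msupp P) (P@_m * (beta i + (degD A m i)%:~R)) *: 'X_[m] = lext w P.
  by apply: eq_bigr => m _; rewrite scalerA.
elim/mpoly_lin_ind: P => [|P Q HP HQ|a P HP|m].
- rewrite [lext w _]linear0 [twisted_euler _ _]linear0 subr0 big1 // => k _.
  by rewrite !mulr0 linear0 mulr0 addr0 scaler0.
- rewrite [lext w _]linearD [twisted_euler _ _]linearD /= -HP -HQ.
  rewrite addrACA -opprD -big_split /=; congr (_ - _).
  by apply: eq_bigr => k _; rewrite mderivD !mulrDr -scalerDr addrACA.
- rewrite [lext w _]linearZ [twisted_euler _ _]linearZ /= -HP scalerBr.
  congr (_ - _); rewrite scaler_sumr; apply: eq_bigr => k _.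
  by rewrite mderivZ -!scalerAr -scalerDr !scalerA mulrC.
rewrite lextX twisted_eulerX /w.
under eq_bigr => k _ do rewrite mulX_mderiv -!mpolyXD addmC scalerDr scalerA.
rewrite big_split /= -addrA; congr (_ + _); rewrite -scaler_suml -scalerBl; congr (_ *: _).
rewrite AdegE /degD /Amul !rmorph_sum /=.
under [X in _ = X - _]eq_bigr => k _ do rewrite dexpE.
rewrite opprD addrCA addrC; congr (_ - _); rewrite -sumrB; apply: eq_bigr => k _.
by rewrite !rmorphM rmorphB /=; ring.
Qed.

End Operators.

(** * The module D_A / D_A I_A *)

Section ToricNull.
Variables (d n : nat) (A : 'M[int]_(d, n)).
Local Notation D := {mpoly CC[n + n]}.
Local Notation weight := ('X_{1..n} -> 'cV[int]_d -> CC^o).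

Definition wlift (w : weight) (m : 'X_{1..n + n}) : CC^o :=
  w (xexp m) (Adeg A (dexp m)).

(** Vanishing in C[x][NA], tested by functionals: a weight prescribes arbitrary values on the
    monomials x^a t^b. Stability under an operator then amounts to transposing it to weights. *)
Definition toric_null (P : D) : Prop := forall w : weight, lext (wlift w) P = 0.

Lemma toric_null0 : toric_null 0.
Proof. by move=> w; rewrite linear0. Qed.

Lemma toric_nullB P Q : toric_null P -> toric_null Q -> toric_null (P - Q).
Proof. by move=> NP NQ w; rewrite linearB /= NP NQ subr0. Qed.

Lemma toric_nullZ a P : toric_null P -> toric_null (a *: P).
Proof. by move=> NP w; rewrite linearZ /= NP scaler0. Qed.

Lemma toric_nullD P Q : toric_null P -> toric_null Q -> toric_null (P + Q).
Proof. by move=> NP NQ w; rewrite linearD /= NP NQ addr0. Qed.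

Lemma toric_null_binomial m m' : xexp m = xexp m' ->
  Adeg A (dexp m) = Adeg A (dexp m') -> toric_null ('X_[m] - 'X_[m']).
Proof. by move=> xm dm w; rewrite linearB /= !lextX /wlift xm dm subrr. Qed.

Lemma xexp_sub (m : 'X_{1..n + n}) (j : 'I_n) : xexp (m - U_(xv j)) = (xexp m - U_(j))%MM.
Proof. by apply/mnmP => k; rewrite !(mnmBE, xexpE, mnm1E) xv_eq. Qed.

Lemma dexp_subx (m : 'X_{1..n + n}) (j : 'I_n) : dexp (m - U_(xv j)) = dexp m.
Proof. by apply/mnmP => k; rewrite !(mnmBE, dexpE, mnm1E) xv_dv subn0. Qed.

Lemma xexp1x (j : 'I_n) : xexp U_(xv j) = U_(j)%MM.
Proof. by apply/mnmP => k; rewrite xexpE !mnm1E xv_eq. Qed.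

Lemma xexp1d (j : 'I_n) : xexp U_(dv j) = 0%MM.
Proof. by apply/mnmP => k; rewrite xexpE !mnmE dv_xv. Qed.

Lemma dexp1x (j : 'I_n) : dexp U_(xv j) = 0%MM.
Proof. by apply/mnmP => k; rewrite dexpE !mnmE xv_dv. Qed.

Lemma dexp1d (j : 'I_n) : dexp U_(dv j) = U_(j)%MM.
Proof. by apply/mnmP => k; rewrite dexpE !mnm1E dv_eq. Qed.

Lemma toric_null_linear (f : {linear D -> D}) :
  (forall w, exists w', forall m, lext (wlift w) (f 'X_[m]) = wlift w' m) ->
  forall P, toric_null P -> toric_null (f P).
Proof.
move=> fw P NP w; have [w' Ew] := fw w; rewrite -[RHS](NP w').
apply: (mpoly_lin_ext (f := lext (wlift w) \o f) (g := lext (wlift w'))) => m.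
by rewrite /= Ew lextX.
Qed.

Lemma toric_null_twisted_euler beta i P : toric_null P -> toric_null (twisted_euler A beta i P).
Proof.
apply: (@toric_null_linear (twisted_euler A beta i)) => w.
exists (fun x b => \sum_k (A i k)%:~R *: w (x + U_(k))%MM (b + col k A)
   + ((b i 0)%:~R - beta i) *: w x b) => m.
rewrite /= twisted_eulerX linearD linear_sum linearZ /= lextX; congr (_ + _).
apply: eq_bigr => k _; rewrite linearZ /= lextX /wlift.
by rewrite xexpD dexpD xexpD dexpD xexp1x xexp1d dexp1x dexp1d addm0 add0m AdegD Adeg1.
Qed.

(* Solves w0 x (b + a_j) + x_j w0 (x - e_j) b = w x b, i.e. inverts the
   transpose of [weyl_del j], by recursion on t = x_j. *)
Fixpoint weyl_del_weight (w : weight) (j : 'I_n) (t : nat) : weight := fun x b =>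
  if t is t'.+1 then
    w x (b - col j A) - t%:R *: weyl_del_weight w j t' (x - U_(j))%MM (b - col j A)
  else w x (b - col j A).

(** The transpose of [weyl_del j] is onto: the value of [w] on [P] is the value of [w0] on
    [weyl_del j P]. *)
Lemma toric_null_weyl_del_inj j P : toric_null (weyl_del j P) -> toric_null P.
Proof.
move=> NP w; pose w0 : weight := fun x b => weyl_del_weight w j (x j) x b.
rewrite -[RHS](NP w0).
apply: (mpoly_lin_ext (f := lext (wlift w)) (g := lext (wlift w0) \o weyl_del j)) => m.
rewrite /= weyl_delX linearD linearZ /= !lextX /wlift xexp_sub dexp_subx.
rewrite xexpD dexpD xexp1d dexp1d addm0 AdegD Adeg1 /w0 -xexpE mnmBE mnm1E eqxx.
case E: (xexp m j) => [|t] /=; first by rewrite addrK scale0r addr0.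
by rewrite addrK subn1 subrK.
Qed.

Lemma in_DIA_D P Q : in_DIA A P -> in_DIA A Q -> in_DIA A (P + Q).
Proof.
move=> [s [Is ->]] [t [It ->]]; exists (s ++ t); rewrite big_cat; split => // q.
by rewrite mem_cat => /orP [/Is|/It].
Qed.

Lemma in_DIA_toric P : in_DIA A P -> toric_null P.
Proof.
move=> [s [Is ->]] w; rewrite linear_sum big_seq big1 // => q /Is Iq.
rewrite /= weyl_mul_embR.
elim/mpoly_lin_ind: q.1 => [|p1 p2 H1 H2|a p1 H1|m0].
- by rewrite mul0r linear0.
- by rewrite mulrDl linearD /= H1 H2 addr0.
- by rewrite -scalerAl linearZ /= H1 scaler0.
pose w' u : CC^o := w (xexp m0) (Adeg A (dexp m0) + Adeg A u).
have -> : lext (wlift w) ('X_[m0] * embR q.2) = lext w' q.2.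
  elim/mpoly_lin_ind: q.2 => [|p1 p2 H1 H2|a p1 H1|u].
  - by rewrite linear0 mulr0 !linear0.
  - by rewrite linearD /= mulrDr !linearD /= H1 H2.
  - by rewrite linearZ /= -scalerAr !linearZ /= H1.
  by rewrite embRX -mpolyXD !lextX /wlift xexpD dexpD xexp_dpart dexp_dpart addm0 AdegD.
apply: in_ideal_functional Iq => g [u [Au ->]] m.
rewrite /= /binom mulrBr -!mpolyXD linearB /= !lextX /w' !AdegD Adeg_upos //.
by rewrite subrr.
Qed.

(** Each monomial is replaced by a chosen representative [rep m] of its class x^a t^b. The
    differences lie in D_A I_A, and the sum of the representatives is zero since its coefficients
    are values of weights on [P]. *)
Lemma toric_in_DIA P : toric_null P -> in_DIA A P.
Proof.
move=> NP; pose same m m' := (xexp m' == xexp m) && (Adeg A (dexp m') == Adeg A (dexp m)).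
pose rep m := choose (same m) m.
have same_rep m : same m (rep m) by apply: chooseP; rewrite /same !eqxx.
have repE m m' : same m m' -> rep m' = rep m.
  move=> smm'; rewrite /rep (@eq_choose _ (same m') (same m)).
    by apply: choose_id => //; rewrite /same !eqxx.
  by case/andP: smm' => /eqP E1 /eqP E2 m2; rewrite /same E1 E2.
pose r m : D := 'X_[rep m].
have Pr0 : lext r P = 0.
  apply/mpolyP => m0; rewrite mcoeff0.
  (* The indicator of the class of [m0], set to zero unless [m0] is its own representative; it reads
     off the coefficient of [m0] in [lext r P]. *)
  pose w : weight := fun x b =>
    ((x == xexp m0) && (b == Adeg A (dexp m0)) && (rep m0 == m0))%:R.
  rewrite -[RHS](NP w); elim/mpoly_lin_ind: P {NP} => [|p q Hp Hq|a p Hp|m].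
  - by rewrite !linear0 ?mcoeff0.
  - by rewrite !linearD ?mcoeffD /= Hp Hq.
  - by rewrite !linearZ ?mcoeffZ /= Hp.
  rewrite /= !lextX /r mcoeffX /wlift /w -/(same m0 m); congr (nat_of_bool _)%:R.
  apply/eqP/andP => [Em|[smm /eqP <-]]; last by rewrite (repE m0 m).
  have := same_rep m; rewrite Em => s0m.
  have s_m : same m0 m by case/andP: s0m => /eqP E1 /eqP E2; rewrite /same E1 E2 !eqxx.
  by split => //; rewrite -(repE _ _ s_m) Em.
have -> : P = \sum_(m <- msupp P) P@_m *: ('X_[m] - 'X_[rep m]).
  transitivity (P - lext r P); first by rewrite Pr0 subr0.
  by rewrite {1}[P]mpolyE -sumrB; apply: eq_bigr => m _; rewrite scalerBr.
elim/big_ind: _ => [||m _]; [by exists [::]; rewrite big_nil | exact: in_DIA_D |].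
have /andP [/eqP xm /eqP dm] := same_rep m.
exists [:: (P@_m *: 'X_[xpart (xexp m)], 'X_[dexp m] - 'X_[dexp (rep m)])].
split => [q|]; first by rewrite inE => /eqP ->; apply: binomial_toric_ideal.
rewrite big_seq1 /= weyl_mul_embR [embR _]linearB /= !embRX -scalerAl mulrBr -!mpolyXD.
by rewrite -expE -xm -expE.
Qed.

Lemma modeqE P Q : modeq A P Q <-> toric_null (P - Q).
Proof. by split; [apply: in_DIA_toric | apply: toric_in_DIA]. Qed.

End ToricNull.

(** * The nonresonant case *)

Section Divisible.
Variables (d n : nat) (A : 'M[int]_(d, n)) (j : 'I_n).

(** A u lies in a_j + NA, which is the condition for d^u to vanish in S_A/<d_j>. *)
Definition divj (u : 'X_{1..n}) : Prop := exists w, Adeg A u = col j A + Adeg A w.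

Lemma divj_le (u v : 'X_{1..n}) : (forall i, u i <= v i)%N -> divj u -> divj v.
Proof.
move=> /mnm_lepP uv [w Ew]; exists (w + (v - u))%MM.
by rewrite AdegD addrA -Ew -AdegD addmC submK.
Qed.

Definition trunc B (u : 'X_{1..n}) : 'X_{1..n} := [multinom minn (u i) B | i < n].

Lemma divj_trunc : exists B, forall u, divj u -> divj (trunc B u).
Proof.
have [u v uv|B HB] := @upset_trunc n (fun u => divj [multinom u i | i < n]).
  by apply: divj_le => i; rewrite !mnmE.
exists B => u Du; have -> : trunc B u = [multinom minn (u i) B | i < n] by [].
apply: HB; apply: divj_le Du => i; by rewrite mnmE.
Qed.

(** Truncating [v + t] at [B] gives at most [v], hence at most [u]. So the coordinates where [v]
    equals [B] are free, and finitely many such cells cover the complement of [divj]. *)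
Lemma trunc_cell B (u v t : 'X_{1..n}) : v = trunc B u -> ~ divj u ->
  (forall u, divj u -> divj (trunc B u)) ->
  (forall k, v k != B -> t k = 0%N) -> ~ divj (v + t).
Proof.
move=> -> ndu HB tJ /HB dvt; apply: ndu; apply: divj_le dvt => i.
rewrite !mnmE; case: (eqVneq (trunc B u i) B) => [E|/tJ ->].
  by rewrite (leq_trans (geq_minr _ _)) // -{1}E mnmE geq_minl.
by rewrite addn0 (leq_trans (geq_minl _ _)) ?geq_minl.
Qed.

Lemma form_Adeg (w : 'I_d -> CC) u :
  \sum_i w i * (Adeg A u i 0)%:~R = \sum_k (u k)%:R * \sum_i w i * (A i k)%:~R.
Proof.
under eq_bigr => i _ do rewrite AdegE /Amul rmorph_sum mulr_sumr.
rewrite exchange_big; apply: eq_bigr => k _; rewrite mulr_sumr.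
by apply: eq_bigr => i _; rewrite rmorphM /= [LHS]mulrA [LHS]mulrC -pmulrn.
Qed.

Lemma form_trunc (w : 'I_d -> CC) B u :
  (forall k, trunc B u k == B -> \sum_i w i * (A i k)%:~R = 0) ->
  \sum_i w i * (Adeg A u i 0)%:~R = \sum_i w i * (Adeg A (trunc B u) i 0)%:~R.
Proof.
move=> w0; rewrite !form_Adeg; apply: eq_bigr => k _.
case: (boolP (trunc B u k == B)) => [/w0 ->|]; first by rewrite !mulr0.
rewrite mnmE => nB; congr (_%:R * _); move: nB.
by rewrite /minn; case: ifP => // _; rewrite eqxx.
Qed.

Lemma divj_ideal u : divj u -> toric_ideal_dj A j 'X_[u].
Proof.
move=> [w Ew]; rewrite -[X in toric_ideal_dj _ _ X](subrK 'X_[w + U_(j)]); apply: in_idealD.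
  have [|s [Ts ->]] := @binomial_toric_ideal d n A u (w + U_(j)).
    by rewrite Ew AdegD Adeg1 addrC.
  by exists s; split => // q /Ts; left.
by rewrite mpolyXD; apply/in_idealM/in_ideal_gen; right.
Qed.

Lemma SAdj_piece_degree u (alpha : 'I_d -> int) : ~ divj u ->
  (forall i, alpha i = - Adeg A u i 0) -> SAdj_piece_nonzero A j alpha.
Proof.
move=> ndu Ealpha; exists 'X_[u]; split.
  move=> m /mem_msuppXP <- i; by rewrite Ealpha AdegE.
(* The indicator of degree A u kills binomials of equal degree, and multiples of d_j because [u] is
   not divisible. *)
pose w v : CC^o := (Adeg A v == Adeg A u)%:R.
move=> Iu; have := in_ideal_functional (f := lext w) _ Iu.
rewrite /= lextX /w eqxx => H; have /eqP := oner_neq0 CC; apply; apply: H.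
move=> g [[e [Ae ->]]|->] m; rewrite /= -/w.
  by rewrite /binom mulrBr -!mpolyXD linearB /= !lextX /w !AdegD Adeg_upos // subrr.
rewrite -mpolyXD lextX /w; case: eqP => // E; case: ndu; exists m.
by rewrite -E AdegD Adeg1 addrC.
Qed.

Lemma SAdj_piece_exponent (alpha : 'I_d -> int) : SAdj_piece_nonzero A j alpha ->
  exists2 u, ~ divj u & forall i, alpha i = - Adeg A u i 0.
Proof.
move=> [p [pdeg Ip]]; apply: NNPP => H; apply: Ip.
rewrite [p]mpolyE; rewrite big_seq.
elim/big_ind: _ => [||m mp]; [exact: in_ideal0 | exact: in_idealD |].
rewrite -mul_mpolyC; apply: in_idealM; apply: divj_ideal.
by apply: NNPP => ndm; apply: H; exists m => // i; rewrite -(pdeg m) // AdegE.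
Qed.

End Divisible.

(** * Moving monomials into the image of d_j by operators homotopic to 1 *)

Section Killing.
Variables (d n : nat) (A : 'M[int]_(d, n)) (beta : 'I_d -> CC) (j : 'I_n).
Local Notation D := {mpoly CC[n + n]}.
Local Notation phi := (twisted_euler A beta).
Local Notation ldel := (weyl_del j).
Local Notation null := (toric_null A).
Implicit Types (P Q : D) (w : 'I_d -> CC) (ws : seq ('I_d -> CC)).

(** If no such form existed, -beta - (m+1) a_j would lie in the closure of the degrees -A(v + t) of
    the cell, and [beta] would be strongly resonant with index [m]. *)
Lemma separating_form v (J : pred 'I_n) m : ~ SRes A j beta ->
  (forall t : 'X_{1..n}, (forall k, ~~ J k -> t k = 0%N) -> ~ divj A j (v + t)) ->
  exists w, (forall k, J k -> \sum_i w i * (A i k)%:~R = 0) /\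
    \sum_i w i * (beta i + m.+1%:R * (A i j)%:~R - (Adeg A v i 0)%:~R) = 1.
Proof.
move=> nS nd.
have [[t [tJ Et]]|[w Hw]] := span_or_separate (fun k i => (A i k)%:~R : CC) J
    (fun i => beta i + m.+1%:R * (A i j)%:~R - (Adeg A v i 0)%:~R); last by exists w.
case: nS; exists m => f fS.
rewrite (@meval_eq_arg _ _ _ _ (fun i => - (Adeg A v i 0)%:~R
    + \sum_k t k * - (A i k)%:~R)); last first.
  move=> i; under eq_bigr => k _ do rewrite mulrN.
  by rewrite sumrN -Et; ring.
apply: (@meval_span_nat _ _ _ f (fun k i => - (A i k)%:~R) J) tJ => t' tJ.
pose u : 'X_{1..n} := [multinom t' k | k < n].
pose alpha i := - Adeg A (v + u) i 0.
rewrite (@meval_eq_arg _ _ _ _ (fun i => (alpha i)%:~R)); last first.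
  move=> i; rewrite /alpha AdegD mxE rmorphN rmorphD opprD /=; congr (_ + _).
  rewrite AdegE /Amul rmorph_sum -sumrN; apply: eq_bigr => k _.
  by rewrite rmorphM mulrN mulrC /= mnmE -pmulrn.
apply: fS; apply: (@SAdj_piece_degree _ _ _ _ (v + u)) => //.
by apply: nd => k /tJ; rewrite mnmE.
Qed.

Definition Top w P : D := P + \sum_i w i *: phi i P.

Lemma Top_is_linear w : linear (Top w).
Proof.
move=> a P Q; rewrite /Top scalerDr scaler_sumr addrACA -big_split; congr (_ + _).
by apply: eq_bigr => i _; rewrite linearP /= scalerDr !scalerA mulrC.
Qed.
HB.instance Definition _ w := GRing.isLinear.Build CC D D *:%R (Top w) (Top_is_linear w).

Definition Tops ws P : D := foldr Top P ws.

Lemma Tops_is_linear ws : linear (Tops ws).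
Proof. by move=> a P Q; elim: ws => //= w ws ->; rewrite linearP. Qed.
HB.instance Definition _ ws := GRing.isLinear.Build CC D D *:%R (Tops ws) (Tops_is_linear ws).

(** The product of the factors [Top w] is expanded from the left, so that its difference from 1 is a
    sum of phi_i composed with [hops ws i]. *)
Fixpoint hops ws (i : 'I_d) (P : D) : D :=
  if ws is w :: ws' then hops ws' i P + w i *: Tops ws' P else 0.

Lemma hops_is_linear ws i : linear (hops ws i).
Proof.
move=> a P Q; elim: ws => [|w ws IH] /=; first by rewrite scaler0 addr0.
by rewrite IH linearP /= !scalerDr !scalerA (mulrC a) addrACA.
Qed.
HB.instance Definition _ ws i :=
  GRing.isLinear.Build CC D D *:%R (hops ws i) (hops_is_linear ws i).

Lemma TopsE ws P : Tops ws P = P + \sum_i phi i (hops ws i P).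
Proof.
elim: ws => [|w ws IH] /=; first by rewrite big1 ?addr0 // => i _; rewrite linear0.
rewrite /Top {1}IH -addrA -big_split; congr (_ + _); apply: eq_bigr => i _.
by rewrite [phi i (_ + _)]linearD /= [phi i (_ *: _)]linearZ.
Qed.

Lemma comm_Tops (f : {linear D -> D}) ws :
  (forall i P, f (phi i P) = phi i (f P)) -> forall P, f (Tops ws P) = Tops ws (f P).
Proof.
move=> fphi P; elim: ws => //= w ws IH; rewrite linearD linear_sum /Top -IH.
by congr (_ + _); apply: eq_bigr => i _; rewrite linearZ /= fphi.
Qed.

Lemma comm_hops (f : {linear D -> D}) ws l :
  (forall i P, f (phi i P) = phi i (f P)) -> forall P, f (hops ws l P) = hops ws l (f P).
Proof.
move=> fphi P; elim: ws => [|w ws IH] /=; first by rewrite linear0.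
by rewrite linearD linearZ /= IH comm_Tops.
Qed.

Lemma Tops_null ws P : null P -> null (Tops ws P).
Proof.
move=> NP; elim: ws => //= w ws IH; apply: toric_nullD => //.
elim/big_ind: _ => [||i _]; [exact: toric_null0 | exact: toric_nullD |].
exact/toric_nullZ/toric_null_twisted_euler.
Qed.

Lemma hops_null ws i P : null P -> null (hops ws i P).
Proof.
move=> NP; elim: ws => [|w ws IH] /=; first exact: toric_null0.
by apply: toric_nullD => //; apply/toric_nullZ/Tops_null.
Qed.

Lemma Tops_ldel ws P : Tops ws (ldel P) = ldel (Tops ws P).
Proof. by apply/esym/(@comm_Tops (weyl_del j)) => i Q /=; rewrite weyl_del_twisted_euler. Qed.

Lemma Tops_phi ws i P : Tops ws (phi i P) = phi i (Tops ws P).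
Proof. by apply/esym/(@comm_Tops (twisted_euler A beta i)) => l Q /=; rewrite twisted_eulerC. Qed.

Lemma hops_phi ws i l P : phi i (hops ws l P) = hops ws l (phi i P).
Proof. by apply: (@comm_hops (twisted_euler A beta i)) => k Q /=; rewrite twisted_eulerC. Qed.

Lemma Tops_cat ws ws' P : Tops (ws ++ ws') P = Tops ws (Tops ws' P).
Proof. by rewrite /Tops foldr_cat. Qed.

Lemma Tops_comm ws ws' P : Tops ws (Tops ws' P) = Tops ws' (Tops ws P).
Proof. by apply: (@comm_Tops (Tops ws)) => i Q /=; rewrite Tops_phi. Qed.

Definition killed_by ws P : Prop := exists Q, null (Tops ws P - ldel Q).

Definition killable P : Prop := exists ws, killed_by ws P.

(** Extra factors commute with [weyl_del j] and so preserve its image. Hence lists can be merged to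
    serve several symbols at once. *)
Lemma killed_by_cat ws ws' P : killed_by ws' P -> killed_by (ws ++ ws') P.
Proof.
move=> [Q NQ]; exists (Tops ws Q).
by rewrite Tops_cat -Tops_ldel -linearB; apply: Tops_null.
Qed.

Lemma killed_by_catC ws ws' P : killed_by (ws ++ ws') P -> killed_by (ws' ++ ws) P.
Proof. by rewrite /killed_by !Tops_cat Tops_comm. Qed.

Lemma killed_by_mod ws P P' Q : null (P - P' - ldel Q) ->
  killed_by ws P' -> killed_by ws P.
Proof.
move=> NQ [Q' NQ']; exists (Q' + Tops ws Q).
rewrite [ldel (_ + _)]linearD /= -Tops_ldel.
have := toric_nullD (Tops_null ws NQ) NQ'; rewrite !linearB /=.
by congr null; ring.
Qed.

Lemma killable_mod P P' Q : null (P - P' - ldel Q) -> killable P' -> killable P.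
Proof. by move=> NQ [ws Hws]; exists ws; apply: killed_by_mod Hws. Qed.

Lemma killable_Top w P : killable (Top w P) -> killable P.
Proof. by move=> [ws H]; exists (ws ++ [:: w]); rewrite /killed_by Tops_cat. Qed.

Lemma killed_byD ws P Q : killed_by ws P -> killed_by ws Q -> killed_by ws (P + Q).
Proof.
move=> [P' NP] [Q' NQ]; exists (P' + Q'); have := toric_nullD NP NQ.
by rewrite [Tops _ (_ + _)]linearD [ldel (_ + _)]linearD /=; congr null; ring.
Qed.

Lemma killableD P Q : killable P -> killable Q -> killable (P + Q).
Proof.
move=> [ws Hws] [ws' Hws']; exists (ws ++ ws'); apply: killed_byD.
  exact/killed_by_catC/killed_by_cat.
exact: killed_by_cat.
Qed.

Lemma killable0 : killable 0.
Proof. by exists [::], 0; rewrite [ldel 0]linear0 subr0; apply: toric_null0. Qed.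

Lemma killableZ a P : killable P -> killable (a *: P).
Proof.
move=> [ws [Q NQ]]; exists ws, (a *: Q).
by rewrite [Tops _ (_ *: _)]linearZ [ldel (_ *: _)]linearZ /= -scalerBr; apply: toric_nullZ.
Qed.

Lemma killable_family (T : finType) (c : T -> D) :
  (forall x, killable (c x)) -> exists ws, forall x, killed_by ws (c x).
Proof.
move=> Kc.
have [ws Hws] : exists ws, forall x, x \in enum T -> killed_by ws (c x).
  elim: (enum T) => [|x s [ws IH]]; first by exists [::].
  have [ws' H] := Kc x; exists (ws ++ ws') => y; rewrite inE => /predU1P [->|/IH].
    exact: killed_by_cat.
  by move=> ?; apply/killed_by_catC/killed_by_cat.
by exists ws => x; apply: Hws; rewrite mem_enum.
Qed.

Lemma TopX w m : Top w 'X_[m] =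
  (1 + \sum_i w i * ((Adeg A (dexp m) i 0)%:~R - beta i)) *: 'X_[m]
  + \sum_k (\sum_i w i * (A i k)%:~R) *: 'X_[m + (U_(xv k) + U_(dv k))].
Proof.
rewrite /Top scalerDl scale1r -addrA; congr (_ + _).
under eq_bigr => i _ do rewrite twisted_eulerX scalerDr scaler_sumr scalerA.
rewrite big_split addrC -scaler_suml; congr (_ + _).
rewrite exchange_big; apply: eq_bigr => k _; rewrite scaler_suml.
by apply: eq_bigr => i _; rewrite scalerA.
Qed.

Hypothesis nonres : ~ SRes A j beta.

(** Outer induction on the exponent [s] of x_j, inner induction on the gap between [rank], the total
    of the truncated d-exponents, and its bound [n * B]. *)
Lemma killable_monomial m : killable 'X_[m].
Proof.
have [B HB] := divj_trunc A j.
move: {2}(m (xv j)) (erefl (m (xv j))) => s.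
elim/ltn_ind: s m => s IHs m ms.
pose rank (u : 'X_{1..n}) := (\sum_k minn (u k) B)%N.
have rank_le u : (rank u <= n * B)%N.
  by rewrite -[n in (n * B)%N]card_ord -sum_nat_const; apply: leq_sum => k _; rewrite geq_minr.
move: {2}(n * B - rank (dexp m))%N (leqnn (n * B - rank (dexp m))) => r.
elim/ltn_ind: r m ms => r IHr m ms rank_m.
case: (classic (divj A j (dexp m))) => [[u Eu]|ndm].
  (* The class of [m] is divisible by t^(a_j), which modulo the image of delta acts as -d/dx_j and
     so lowers [s]. *)
  pose m' := (xpart (xexp m) + dpart u)%MM.
  have xm' : xexp m' = xexp m by rewrite xexpD xexp_xpart xexp_dpart addm0.
  have m's : m' (xv j) = s by rewrite -xexpE xm' xexpE.
  apply: (@killable_mod _ (- (s%:R *: 'X_[m' - U_(xv j)])) 'X_[m']).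
    rewrite weyl_delX m's opprK opprD addrACA subrr addr0; apply: toric_null_binomial.
      by rewrite xexpD xm' xexp1d addm0.
    by rewrite !dexpD dexp_xpart dexp_dpart dexp1d add0m AdegD Adeg1 Eu addrC.
  rewrite -scaleNr; case: s m's {ms IHr} IHs => [|s] m's IHs.
    by rewrite oppr0 scale0r; apply: killable0.
  apply: killableZ; apply: (IHs s) => //.
  by rewrite mnmBE mnm1E eqxx m's subn1.
pose v := trunc B (dexp m); pose J k := v k == B.
(* Taking [s] as the resonance index makes the diagonal coefficient of [Top w] equal to
   [s.+1%:R * a j] in [Ew]. *)
have [t tJ|w [wJ wv]] := @separating_form v J s nonres.
  exact: trunc_cell ndm HB tJ.
apply: (@killable_Top w).
pose a k := \sum_i w i * (A i k)%:~R.
have {}wJ k : J k -> a k = 0 by exact: wJ.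
have -> : Top w 'X_[m] = (1 + \sum_i w i * ((Adeg A (dexp m) i 0)%:~R - beta i)) *: 'X_[m]
    + \sum_k a k *: 'X_[m + (U_(xv k) + U_(dv k))] by exact: TopX.
have Ew : 1 + \sum_i w i * ((Adeg A (dexp m) i 0)%:~R - beta i) = s.+1%:R * a j.
  have wuv : \sum_i w i * (Adeg A (dexp m) i 0)%:~R = \sum_i w i * (Adeg A v i 0)%:~R.
    exact: form_trunc.
  apply: (etrans (y := \sum_i w i * (beta i + s.+1%:R * (A i j)%:~R - (Adeg A v i 0)%:~R)
      + \sum_i w i * ((Adeg A (dexp m) i 0)%:~R - beta i))); first by rewrite wv.
  rewrite mulr_sumr; apply/eqP; rewrite -subr_eq0 -big_split -sumrB; apply/eqP.
  apply: (etrans (y := \sum_i w i * (Adeg A (dexp m) i 0)%:~R - \sum_i w i * (Adeg A v i 0)%:~R)).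
    by rewrite -sumrB; apply: eq_bigr => i _ /=; ring.
  by rewrite wuv subrr.
rewrite Ew (bigD1 j) //=.
(* The diagonal term and the term [k = j] together are delta of [a j *: 'X_[m + U_(xv j)]], the
   derivative of x_j^(s+1) supplying the factor s+1. *)
apply: (@killable_mod _ (\sum_(k | k != j) a k *: 'X_[m + (U_(xv k) + U_(dv k))])
   (a j *: 'X_[m + U_(xv j)])).
  have -> : ldel (a j *: 'X_[m + U_(xv j)])
      = a j *: 'X_[m + (U_(xv j) + U_(dv j))] + (s.+1%:R * a j) *: 'X_[m].
    rewrite linearZ /= weyl_delX addmK mnmDE mnm1E eqxx ms addn1 scalerDr scalerA.
    by rewrite -addmA (mulrC (a j)).
  rewrite [X in null X](_ : _ = 0); first exact: toric_null0.
  ring.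
elim/big_ind: _ => [||k kj]; [exact: killable0 | exact: killableD |].
case: (boolP (J k)) => [/wJ ->|nJ]; first by rewrite scale0r; apply: killable0.
apply: killableZ.
(* A surviving [k] lies outside [J], so its d-exponent is below [B] and [rank] increases; since
   [k != j], [s] is unchanged. *)
have mk : (m (dv k) < B)%N.
  by move: nJ; rewrite /J /v mnmE dexpE /minn; case: ifP => // _; rewrite eqxx.
have dk : dexp (m + (U_(xv k) + U_(dv k))) = (dexp m + U_(k))%MM.
  by rewrite !dexpD dexp1x dexp1d add0m.
have lt_rank : (rank (dexp m) < rank (dexp (m + (U_(xv k) + U_(dv k)))))%N.
  rewrite dk /rank (bigD1 k) //= [X in (_ < X)%N](bigD1 k) //= -addSn leq_add //.
    by rewrite mnmDE mnm1E eqxx dexpE; lia.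
  by apply: leq_sum => l _; rewrite mnmDE; lia.
apply: (IHr _ _ _ _ (leqnn _)).
  by apply: leq_trans rank_m; have := rank_le (dexp (m + (U_(xv k) + U_(dv k)))); lia.
by rewrite !mnmDE !mnm1E xv_eq dv_xv (negbTE kj) !addn0.
Qed.

Lemma killable_all P : killable P.
Proof.
by elim/mpoly_lin_ind: P; [exact: killable0 | exact: killableD | exact: killableZ |
  exact: killable_monomial].
Qed.

End Killing.

(** * Transfer to the Koszul complex of S_A, and cells at resonant parameters *)

Section QuasiIso.
Variables (d n : nat) (A : 'M[int]_(d, n)) (beta : 'I_d -> CC) (j : 'I_n).

Lemma kdiffE c tau : kdiff A beta c tau = koszul_diff (twisted_euler A beta) c tau.
Proof. by apply: eq_bigr => i _; rewrite kphiE. Qed.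

Lemma mul_djE c (sigma : {set 'I_d}) : mul_dj j c sigma = weyl_del j (c sigma).
Proof. by rewrite /mul_dj weyl_mul_d. Qed.

Lemma kcycleE k c : kcycle A beta k c <->
  forall tau : {set 'I_d}, #|tau|.+1 = k -> toric_null A (koszul_diff (twisted_euler A beta) c tau).
Proof.
by split => H tau /H; rewrite modeqE subr0 kdiffE.
Qed.

Lemma nonresonant_quasi_iso : ~ SRes A j beta -> dj_quasi_iso A beta j.
Proof.
move=> nS.
have killed (c : {set 'I_d} -> {mpoly CC[n + n]}) :
    exists (T : {linear {mpoly CC[n + n]} -> {mpoly CC[n + n]}})
      (h : 'I_d -> {linear {mpoly CC[n + n]} -> {mpoly CC[n + n]}}),
  [/\ forall i v, T (twisted_euler A beta i v) = twisted_euler A beta i (T v),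
      forall v, T (weyl_del j v) = weyl_del j (T v) &
      forall v, toric_null A v -> toric_null A (T v)] /\
  [/\ forall v, T v = v + \sum_i twisted_euler A beta i (h i v),
      forall i l v, twisted_euler A beta i (h l v) = h l (twisted_euler A beta i v),
      forall i v, toric_null A v -> toric_null A (h i v) &
      forall sigma, exists y, toric_null A (T (c sigma) - weyl_del j y)].
  (* A chain has finitely many coefficients, so one list of forms serves them all. *)
  have [ws Hws] := killable_family (fun sigma => killable_all nS (c sigma)).
  exists (Tops A beta ws), (hops A beta ws); split; split.
  - exact: Tops_phi.
  - exact: Tops_ldel.
  - exact: Tops_null.
  - exact: TopsE.
  - exact: hops_phi.
  - exact: hops_null.
  - exact: Hws.
move=> k; split => [c /kcycleE cyc [b Hb]|c /kcycleE cyc].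
  have [|b' Hb'] := koszul_mul_injective (delta := weyl_del j) (toric_null0 A)
    (@toric_nullB _ _ A) (@toric_nullZ _ _ A) (@toric_null_twisted_euler _ _ A beta)
    (@weyl_del_twisted_euler _ _ A beta j) (@toric_null_weyl_del_inj _ _ A j) killed cyc.
    by exists b => sigma /Hb; rewrite modeqE kdiffE mul_djE.
  by exists b' => sigma /Hb'; rewrite modeqE kdiffE.
have [c' cyc' [b Hb]] := koszul_mul_surjective (delta := weyl_del j) (toric_null0 A)
    (@toric_nullB _ _ A) (@toric_nullZ _ _ A) (@toric_null_twisted_euler _ _ A beta)
    (@weyl_del_twisted_euler _ _ A beta j) (@toric_null_weyl_del_inj _ _ A j) killed cyc.
exists c'; split; first exact/kcycleE.
by exists b => sigma /Hb; rewrite modeqE kdiffE mul_djE.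
Qed.

(** Every symbol is a 0-cycle, because no set satisfies [#|tau|.+1 = 0]. Surjectivity on H_0 writes
    it, up to null elements, through the images of delta and the phi_i. *)
Lemma quasi_iso_functional_eq0 (V : lmodType CC) (f : {linear {mpoly CC[n + n]} -> V}) :
  dj_quasi_iso A beta j ->
  (forall P, toric_null A P -> f P = 0) -> (forall P, f (weyl_del j P) = 0) ->
  (forall i P, f (twisted_euler A beta i P) = 0) -> forall P, f P = 0.
Proof.
move=> qi fN f_ldel f_phi P.
have [c' [_ [b]]] := (qi 0%N).2 (fun=> P) (fun tau H => False_ind _ (PeanoNat.Nat.neq_succ_0 _ H)).
move=> /(_ set0 (cards0 _)); rewrite modeqE kdiffE mul_djE => /fN.
rewrite !linearB /= f_ldel linear_sum [X in _ - X]big1 => [/eqP|i _].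
  by rewrite sub0r subr0 oppr_eq0 => /eqP.
by rewrite linearZ /= f_phi scaler0.
Qed.

(** The degrees lie in finitely many cells. If every cell were separated from [z] by a polynomial,
    the product of these would vanish on all degrees but not at [z]. *)
Lemma resonance_cell : SRes A j beta -> exists k v (J : pred 'I_n),
  (forall t : 'X_{1..n}, (forall l, ~~ J l -> t l = 0%N) -> ~ divj A j (v + t)) /\
  exists t : 'I_n -> CC, (forall l, ~~ J l -> t l = 0) /\
    forall i, beta i + k.+1%:R * (A i j)%:~R - (Adeg A v i 0)%:~R
      = \sum_l t l * (A i l)%:~R.
Proof.
move=> [k Zk]; exists k; apply: NNPP => H.
have [B HB] := divj_trunc A j.
pose z i := - beta i - k.+1%:R * (A i j)%:~R.
pose mon (v : {ffun 'I_n -> 'I_B.+1}) : 'X_{1..n} := [multinom (v i : nat) | i < n].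
have Hv v : exists gv : {mpoly CC[d]}, gv.@[z] = 1 /\
    forall u, trunc B u = mon v -> ~ divj A j u ->
      gv.@[fun i => (- Adeg A u i 0)%:~R] = 0.
  case: (classic (exists2 u, trunc B u = mon v & ~ divj A j u)) => [[u0 Eu0 ndu0]|nu]; last first.
    by exists 1; rewrite meval1; split => // u Eu ndu; case: nu; exists u.
  pose J l := mon v l == B.
  have nd (t : 'X_{1..n}) : (forall l, ~~ J l -> t l = 0%N) -> ~ divj A j (mon v + t).
    move=> tJ; exact: (trunc_cell (esym Eu0) ndu0 HB).
  have [t|[w [wJ wv]]] := span_or_separate (fun k i => (A i k)%:~R : CC) J
    (fun i => beta i + k.+1%:R * (A i j)%:~R - (Adeg A (mon v) i 0)%:~R).
    by case: H; exists (mon v), J.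
  (* An affine form with value 1 at [z] by [wv]; it vanishes at -A u throughout the cell, where [w]
     takes the same value on A u as on A (mon v). *)
  exists (- \sum_i w i *: ('X_i + ((Adeg A (mon v) i 0)%:~R)%:MP)).
  have gE x : (- \sum_i w i *: ('X_i + ((Adeg A (mon v) i 0)%:~R)%:MP)).@[x]
      = - \sum_i w i * (x i + (Adeg A (mon v) i 0)%:~R).
    rewrite mevalN (raddf_sum (meval x)); congr (- _); apply: eq_bigr => i _ /=.
    by rewrite mevalZ mevalD mevalXU mevalC.
  split => [|u Eu _]; rewrite gE.
    by rewrite -sumrN -[RHS]wv; apply: eq_bigr => i _; rewrite /z; ring.
  apply/eqP; rewrite oppr_eq0; apply/eqP.
  under eq_bigr => i _ do rewrite rmorphN mulrDr mulrN addrC.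
  rewrite sumrB (@form_trunc _ _ A w B u) Eu ?subrr //.
have [g Hg] := fin_all_exists Hv.
have : (\prod_v g v).@[z] = 0.
  apply: Zk => alpha /SAdj_piece_exponent [u ndu Eu].
  have tE : trunc B u = mon [ffun i => inord (trunc B u i)].
    by apply/mnmP => i; rewrite [in RHS]mnmE ffunE inordK // ltnS mnmE geq_minr.
  have := (Hg _).2 u tE ndu; set v := [ffun i => _] => gv0.
  rewrite (rmorph_prod (meval _)) (bigD1 v) //=.
  rewrite (@meval_eq_arg _ _ _ _ (fun i => (- Adeg A u i 0)%:~R)) ?gv0 ?mul0r // => i.
  by rewrite Eu.
rewrite (rmorph_prod (meval _)) big1 => [|v _]; last exact: (Hg v).1.
by move/eqP; rewrite oner_eq0.
Qed.

End QuasiIso.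

(** * The resonant case *)

(** As in Caratheodory's theorem: a multiple of a dependency [r] is subtracted so that the
    coordinate [l0] becomes zero, and [J] shrinks. *)
Lemma independent_support (F : fieldType) n d (a : 'I_n -> 'I_d -> F)
    (J : {set 'I_n}) (t : 'I_n -> F) :
  (forall l, l \notin J -> t l = 0) ->
  exists2 S : {set 'I_n}, S \subset J &
  exists2 s : 'I_n -> F,
    (forall l, l \notin S -> s l = 0) /\
    (forall i, \sum_l t l * a l i = \sum_l s l * a l i) &
    forall r : 'I_n -> F, (forall l, l \notin S -> r l = 0) ->
      (forall i, \sum_l r l * a l i = 0) -> forall l, r l = 0.
Proof.
move: {2}#|J| (leqnn #|J|) => m; elim: m J t => [|m IH] J t leJ tJ.
  exists J => //; exists t => // r rJ _ l; apply: rJ.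
  by move: leJ; rewrite leqn0 cards_eq0 => /eqP ->; rewrite inE.
case: (classic (exists2 r : 'I_n -> F, (forall l, l \notin J -> r l = 0) /\
    (forall i, \sum_l r l * a l i = 0) & exists l, r l != 0)) => [|H]; last first.
  exists J => //; exists t => // r rJ ra l; apply/eqP/negPn/negP => rl.
  by apply: H; exists r => //; exists l.
move=> [r [rJ ra] [l0 rl0]].
have l0J : l0 \in J by apply: contraNT rl0 => /rJ ->.
pose t' l := t l - t l0 / r l0 * r l.
have leJ' : (#|J :\ l0| <= m)%N by move: leJ; rewrite (cardsD1 l0) l0J.
have t'J l : l \notin J :\ l0 -> t' l = 0.
  rewrite !inE negb_and negbK => /predU1P [->|lJ].
    by rewrite /t' divfK // subrr.
  by rewrite /t' (rJ l) // (tJ l) // mulr0 subrr.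
have [S SJ [s [sS sE] indep]] := IH (J :\ l0) t' leJ' t'J.
exists S; first by apply: subset_trans SJ (subD1set _ _).
exists s => //; split => // i; rewrite -sE /t'.
under [RHS]eq_bigr => l _ do rewrite mulrBl -!mulrA.
by rewrite sumrB -!mulr_sumr ra !mulr0 subr0.
Qed.

Lemma ex_maximal (T : Type) (P : T -> Prop) (f : T -> nat) N :
  (exists x, P x) -> (forall x, P x -> f x <= N)%N ->
  exists2 x, P x & forall y, P y -> (f y <= f x)%N.
Proof.
move=> [x Px] fN; move: {2}(N - f x)%N (leqnn (N - f x)) => r.
elim: r x Px => [|r IH] x Px le_r.
  exists x => // y Py; have := fN y Py; have := fN x Px; lia.
case: (classic (exists2 y, P y & (f x < f y)%N)) => [[y Py lt_xy]|H]; last first.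
  by exists x => // y Py; rewrite leqNgt; apply/negP => lt_xy; apply: H; exists y.
by apply: (IH y) => //; have := fN y Py; lia.
Qed.

(* A solution of g (z + 1) = (z - t) g z normalised at z0; below z0 the recursion is
   solved downwards by division, so it fails at z = t if t is an integer below z0. *)
Lemma gamma_recursion (F : numFieldType) (t : F) (z0 : int) : exists g : int -> F,
  [/\ g z0 = 1,
      forall z, z0 <= z \/ z%:~R != t -> g (z + 1) = (z%:~R - t) * g z &
      forall y z, y%:~R = t -> z0 <= y -> y < z -> g z = 0].
Proof.
pose g z := if z - z0 is Posz p then \prod_(i < p) ((z0 + i%:Z)%:~R - t)
  else \prod_(i < absz (z - z0)%R) ((z0 - 1 - i%:Z)%:~R - t)^-1.
have gpos p : g (z0 + p%:Z) = \prod_(i < p) ((z0 + i%:Z)%:~R - t).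
  by rewrite /g addrC addKr.
have gneg p : g (z0 - p%:Z) = \prod_(i < p) ((z0 - 1 - i%:Z)%:~R - t)^-1.
  rewrite /g addrC addKr; case: p => [|p]; first by rewrite (_ : - 0%:Z = 0%:Z) //= !big_ord0.
  by rewrite -NegzE.
have grec z : z0 <= z \/ z%:~R != t -> g (z + 1) = (z%:~R - t) * g z.
  case: (lerP z0 z) => [le_z _|lt_z [//|zt]].
    have -> : z = z0 + (absz (z - z0)%R)%:Z by lia.
    by rewrite -addrA (gpos _) -[_%:Z + 1]/(Posz (_ + 1)) addn1 gpos big_ord_recr /= mulrC.
  have [p Ez] : exists p : nat, z = z0 - (p.+1)%:Z.
    by exists (absz (z0 - z - 1)%R); lia.
  have -> : z + 1 = z0 - p%:Z by lia.
  rewrite {2}Ez !gneg big_ord_recr /=.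
  have -> : z0 - 1 - p%:Z = z by lia.
  by rewrite mulrCA mulfV ?mulr1 // subr_eq0.
exists g; split => //.
  by rewrite -[z0]addr0 (gpos 0%N) big_ord0.
move=> y z Ey z0y yz.
have -> : z = y + 1 + (absz (z - y - 1)%R)%:Z by lia.
elim: absz => [|p IH].
  by rewrite addr0 grec ?Ey ?subrr ?mul0r //; left.
have -> : y + 1 + p.+1%:Z = y + 1 + p%:Z + 1 by lia.
by rewrite grec ?IH ?mulr0 //; left; lia.
Qed.

(** * The weight attached to a resonant cell *)

Section Resonant.
Variables (d n : nat) (A : 'M[int]_(d, n)) (beta : 'I_d -> CC) (j : 'I_n).

Definition icomb (z : 'I_n -> int) : 'cV[int]_d := \sum_l col l A *~ z l.

Lemma icombE z i : icomb z i 0 = \sum_l A i l * z l.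
Proof.
by rewrite summxE; apply: eq_bigr => l _; rewrite -scaler_int mxE mxE intz mulrC.
Qed.

Lemma icombD z z' : icomb (fun l => z l + z' l) = icomb z + icomb z'.
Proof. by rewrite -big_split; apply: eq_bigr => l _; rewrite mulrzDr. Qed.

Lemma icomb_nat (u : 'X_{1..n}) : icomb (fun l => (u l)%:Z) = Adeg A u.
Proof. by apply: eq_bigr => l _; rewrite -pmulrn. Qed.

Lemma icomb_delta l0 : icomb (fun l => (l == l0)%:R) = col l0 A.
Proof.
rewrite /icomb (bigD1 l0) //= eqxx mulr1z big1 ?addr0 // => l /negbTE ->.
by rewrite mulr0z.
Qed.

(** [rho] lives on the coset of [c0] under the lattice of independent columns [S], as a product of
    solutions of the gamma recursion. Points of NA - N a_j are the only ones where the recursion is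
    required. *)
Lemma resonant_weight : SRes A j beta ->
  exists (S : {set 'I_n}) (rho : 'cV[int]_d -> CC),
  [/\ j \notin S,
      forall u, rho (col j A + Adeg A u) = 0,
      forall u m i, let c := Adeg A u - col j A *+ m in
        ((c i 0)%:~R - beta i - (A i j)%:~R) * rho c
          = \sum_(l in S) (A i l)%:~R * rho (c + col l A) &
      exists u m, rho (Adeg A u - col j A *+ m) != 0].
Proof.
move=> /resonance_cell [k [v [J [cell [t0 [t0J Et0]]]]]].
have [l|S SJ [t [tS tE] indep]] :=
  @independent_support _ n d (fun l i => (A i l)%:~R : CC) [set l | J l] t0.
  by rewrite inE => /t0J.
have SJ' l : ~~ J l -> l \notin S.
  by move=> nJ; apply: contra nJ => /(subsetP SJ); rewrite inE.
exists S.
pose supp (z : 'I_n -> int) := forall l, l \notin S -> z l = 0.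
pose c0 := Adeg A v - col j A *+ k.
have icomb_inj z z' : supp z -> supp z' -> icomb z = icomb z' -> z =1 z'.
  move=> zS z'S E l; apply/eqP; rewrite -subr_eq0 -(intr_eq0 CC); apply/eqP.
  apply: (indep (fun l => (z l - z' l)%:~R)) => [l'|i].
    by move=> l'S; rewrite zS // z'S // subrr.
  transitivity ((icomb z i 0 - icomb z' i 0)%:~R : CC); last by rewrite E subrr.
  rewrite !icombE -sumrB rmorph_sum; apply: eq_bigr => l' _ /=.
  by rewrite -rmorphM -mulrBr mulrC.
have jS : j \notin S.
  apply/negP => /(subsetP SJ); rewrite inE => Jj.
  apply: (cell U_(j)%MM) => [l|]; last by exists v; rewrite AdegD Adeg1 addrC.
  by rewrite mnm1E; case: eqP => // <-; rewrite Jj.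
pose Lat z := supp z /\ exists u m, c0 + icomb z = Adeg A u - col j A *+ m.
have [y Hy] : exists y : 'I_n -> option int, forall l,
    if y l is Some a then a%:~R = t l else forall a : int, a%:~R != t l.
  apply: (fin_all_exists (P := fun l (y : option int) =>
    if y is Some a then a%:~R = t l else forall a : int, a%:~R != t l)) => l.
  case: (classic (exists a : int, a%:~R = t l)) => [[a Ea]|H]; first by exists (Some a).
  by exists None => a; apply/eqP => E; apply: H; exists a.
pose low (z : 'I_n -> int) := [set l in S | if y l is Some a then z l <= a else false].
(* The base point of the recursions: among the coset points of NA - N a_j it is at or below the
   integral [t l] in as many coordinates as possible. *)
have [||zs [zsS [us [ms Eus]]] zs_max] := @ex_maximal _ Lat (fun z => #|low z|) n.
- exists (fun=> 0); split => //; exists v, k.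
  by rewrite /icomb big1 ?addr0 // => l _; rewrite mulr0z.
- by move=> z _; rewrite -[n in (_ <= n)%N]card_ord max_card.
have [g Hg] := fin_all_exists (fun l => gamma_recursion (t l) (zs l)).
pose G z := \prod_(l in S) g l (z l).
(* Independence of the columns makes the coordinates [z], hence [G z], well defined on the coset;
   elsewhere the value is zero. *)
have [rho Hrho] : exists rho : 'cV[int]_d -> CC, forall c,
    (forall z, supp z -> c = c0 + icomb z -> rho c = G z) /\
    (~ (exists2 z, supp z & c = c0 + icomb z) -> rho c = 0).
  apply: (functional_choice (fun c y =>
    (forall z, supp z -> c = c0 + icomb z -> y = G z) /\
    (~ (exists2 z, supp z & c = c0 + icomb z) -> y = 0))) => c.
  case: (classic (exists2 z, supp z & c = c0 + icomb z)) => [[z zS Ez]|H]; last first.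
    by exists 0; split => // z zS Ez; case: H; exists z.
  exists (G z); split => [z' z'S|[]]; last by exists z.
  rewrite Ez => /addrI /icomb_inj zz'; apply: eq_bigr => l _; rewrite zz' //.
have rhoE z : supp z -> rho (c0 + icomb z) = G z by move=> zS; apply: (Hrho _).1.
have rho0 c : ~ (exists2 z, supp z & c = c0 + icomb z) -> rho c = 0 by apply: (Hrho c).2.
exists rho; split => //.
(* Moving the negative part of [z] and the [k] copies of a_j to the other side would make a point of
   the cell divisible. *)
- move=> u; apply: rho0 => -[z zS Ez].
  pose zp : 'X_{1..n} := [multinom (if z l is Posz p then p else 0%N) | l < n].
  pose zn : 'X_{1..n} := [multinom (if z l is Posz p then 0%N else absz (z l)) | l < n].
  have zE : icomb z + Adeg A zn = Adeg A zp.
    rewrite -!icomb_nat -icombD; apply: eq_bigr => l _; congr (_ *~ _).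
    by rewrite !mnmE; case: (z l) => p /=; lia.
  apply: (cell zp) => [l /SJ' lS|]; first by rewrite mnmE zS.
  exists (u + U_(j) *+ k + zn)%MM; rewrite !AdegD -zE.
  have -> : Adeg A (U_(j) *+ k)%MM = col j A *+ k.
    by elim: (k) => [|k' IH]; rewrite ?mulm0n ?mulmS ?AdegD ?IH ?Adeg1 ?mulrS //
      /Adeg big1 // => l _; rewrite mnm0E.
  have -> : Adeg A v = c0 + col j A *+ k by rewrite subrK.
  by rewrite addrACA addrA -Ez !addrA (addrAC _ _ (Adeg A zn)) .
- move=> u m i c.
  case: (classic (exists2 z, supp z & c = c0 + icomb z)) => [[z zS Ez]|nc]; last first.
    rewrite rho0 // mulr0 big1 // => l lS; rewrite rho0 ?mulr0 // => -[z zS Ez].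
    pose z' l' := z l' - (l' == l)%:R.
    have zz' : icomb z = icomb z' + col l A.
      by rewrite -icomb_delta -icombD; apply: eq_bigr => l' _; rewrite subrK.
    apply: nc; exists z'; last by apply: (addIr (col l A)); rewrite Ez zz' addrA.
    move=> l' l'S; rewrite /z' zS //; case: eqP => [E|]; last by rewrite subr0.
    by rewrite -E (negbTE l'S) in lS.
  have step l : l \in S -> rho (c + col l A) = ((z l)%:~R - t l) * rho c.
    move=> lS; rewrite Ez -addrA -icomb_delta -icombD !rhoE //; last first.
      move=> l' l'S; rewrite zS // add0r; case: eqP => // E.
      by rewrite E lS in l'S.
    rewrite /G (bigD1 l) //= [in RHS](bigD1 l) //= eqxx mulrA.
    rewrite (eq_bigr (fun l' => g l' (z l'))); last first.
      by move=> l' /andP [_ /negbTE ->]; rewrite addr0.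
    case: (eqVneq (\prod_(l' in S | l' != l) g l' (z l')) 0) => [->|]; first by rewrite !mulr0.
    move=> /prodf_neq0 gnz; congr (_ * _).
    have [_ grec _] := Hg l; apply: grec.
    case: (lerP (zs l) (z l)) => [|lt_z]; [by left | right].
    (* At a failure, z_l = t_l lies below zs_l while the other factors are nonzero. Then [z] is low
       wherever [zs] is, and also at [l], against maximality. *)
    apply/negP => /eqP zt.
    have : (#|low z| <= #|low zs|)%N.
      by apply: zs_max; split => //; exists u, m; rewrite -Ez.
    apply/negP; rewrite -ltnNge; apply: proper_card; apply/properP; split.
      apply/subsetP => l'; rewrite !inE => /andP [l'S]; rewrite l'S.
      move: (Hy l'); case Ey : (y l') => [a|//] Ea le_a.
      case: (eqVneq l' l) => [E|l'l].
        move: Ea; rewrite E -zt => /eqP; rewrite eqr_int => /eqP ->.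
        exact: lexx.
      rewrite leNgt; apply/negP => lt_a.
      have [_ _ gz] := Hg l'; have := gnz l'; rewrite l'S l'l => /(_ isT).
      by rewrite (gz a) ?eqxx.
    exists l; rewrite !inE lS /=; move: (Hy l); case: (y l) => [a|/(_ (z l))]; rewrite ?zt ?eqxx //.
      by rewrite -zt => /eqP; rewrite eqr_int => /eqP ->.
    by rewrite -zt => /eqP; rewrite eqr_int => /eqP ->; rewrite -ltNge.
  (* The factors z_l - t_l combine to c - c0 - (beta + (k+1) a_j - A v), which is c - beta - a_j as
     c0 = A v - k a_j. *)
  under eq_bigr => l lS do rewrite step // mulrA.
  rewrite -mulr_suml; congr (_ * _).
  have sumS (f : 'I_n -> CC) : (forall l, l \notin S -> f l = 0) ->
      \sum_(l in S) (A i l)%:~R * f l = \sum_l f l * (A i l)%:~R.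
    move=> fS; rewrite [RHS](bigID (mem S)) /= [X in _ + X]big1 ?addr0.
      by apply: eq_bigr => l _; rewrite mulrC.
    by move=> l /fS ->; rewrite mul0r.
  rewrite sumS => [|l lS]; last by rewrite tS // zS // subrr.
  under eq_bigr => l _ do rewrite mulrBl.
  rewrite sumrB -tE -Et0 Ez mxE icombE /c0 !mxE mulmxnE mxE !rmorphD rmorphN rmorph_sum /=.
  rewrite (eq_bigr (fun l => (z l)%:~R * (A i l)%:~R)); last by move=> l _; rewrite rmorphM mulrC.
  by rewrite rmorphMn /= -[_%:~R *+ k]mulr_natl -natr1; ring.
exists us, ms; rewrite -Eus rhoE // /G big1 ?oner_neq0 // => l _.
by have [-> _ _] := Hg l.
Qed.

End Resonant.

Section Final.
Variables (d n : nat) (A : 'M[int]_(d, n)) (beta : 'I_d -> CC) (j : 'I_n).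

(** The weight [lam] gives a functional on D_A (x) S_A that vanishes on the images of delta and of
    all phi_i, yet is nonzero. *)
Lemma resonant_not_quasi_iso : SRes A j beta -> ~ dj_quasi_iso A beta j.
Proof.
move=> /resonant_weight [S [rho [jS rho_div rho_rec [u0 [m0 rho_nz]]]]] qi.
(* x_k is evaluated at -1 for k in [S], which gives the recursion of [rho] the right sign, and at 0
   for the other k different from j, with 0^0 = 1. *)
pose e k : CC := if k \in S then -1 else 0.
pose pw (x : 'X_{1..n}) : CC := \prod_(k < n | k != j) e k ^+ x k.
pose q s : CC := (-1) ^+ s * (s`!)%:R.
have qS s : q s.+1 = - (s.+1%:R * q s).
  by rewrite /q exprS factS natrM; ring.
pose lam x b : CC^o := pw x * (q (x j) * rho (b - col j A *+ x j)).
have pwj (x x' : 'X_{1..n}) : (forall k, k != j -> x k = x' k) -> pw x = pw x'.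
  by move=> xx'; apply: eq_bigr => k /xx' ->.
have lam0 P : toric_null A P -> lext (wlift A lam) P = 0 by apply.
have lam_del P : lext (wlift A lam) (weyl_del j P) = 0.
  elim/mpoly_lin_ind: P => [|P Q HP HQ|a P HP|m].
  - by rewrite !linear0.
  - by rewrite [weyl_del j (_ + _)]linearD [lext _ _]linearD /= HP HQ addr0.
  - by rewrite [weyl_del j (_ *: _)]linearZ [lext _ _]linearZ /= HP scaler0.
  rewrite weyl_delX linearD linearZ /= !lextX /wlift /lam xexp_sub dexp_subx.
  rewrite xexpD dexpD xexp1d dexp1d addm0 AdegD Adeg1 -xexpE.
  rewrite mnmBE mnm1E eqxx; set x := xexp m; set b := Adeg A (dexp m).
  rewrite (pwj (x - U_(j))%MM x); last first.
    by move=> k kj; rewrite mnmBE mnm1E eq_sym (negbTE kj) subn0.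
  (* Without x_j only [rho] on a_j + NA occurs, where it is zero; otherwise the two terms cancel by
     [qS]. *)
  case: (x j) => [|s].
    by rewrite scale0r addr0 mulr0n subr0 [b + _]addrC rho_div !mulr0.
  rewrite subn1 /= qS [col j A *+ _]mulrSr opprD addrA addrAC addrK.
  by rewrite -[_ *: _]/(_ * _); ring.
have lam_phi i P : lext (wlift A lam) (twisted_euler A beta i P) = 0.
  elim/mpoly_lin_ind: P => [|P Q HP HQ|a P HP|m].
  - by rewrite !linear0.
  - by rewrite [twisted_euler A beta i (_ + _)]linearD [lext _ _]linearD /= HP HQ addr0.
  - by rewrite [twisted_euler A beta i (_ *: _)]linearZ [lext _ _]linearZ /= HP scaler0.
  rewrite twisted_eulerX linearD linear_sum linearZ /= lextX.
  set x := xexp m; set b := Adeg A (dexp m); set s := x j.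
  have termE k : lext (wlift A lam) ((A i k)%:~R *: 'X_[m + (U_(xv k) + U_(dv k))])
      = (A i k)%:~R * (pw (x + U_(k))%MM *
          (q ((x + U_(k))%MM j) * rho (b + col k A - col j A *+ ((x + U_(k))%MM j)))).
    by rewrite linearZ /= lextX /wlift !xexpD !dexpD xexp1x xexp1d dexp1x dexp1d addm0
      add0m AdegD Adeg1.
  under eq_bigr => k _ do rewrite termE.
  rewrite (bigD1 j) //= mnmDE mnm1E eqxx addn1 (pwj _ x); last first.
    by move=> k kj; rewrite mnmDE mnm1E eq_sym (negbTE kj) addn0.
  rewrite -/s qS [col j A *+ _]mulrSr opprD addrA addrAC addrK.
  set c := b - col j A *+ s.
  (* The term [k = j] contributes -(s+1) a_ij. The part s a_ij turns b into c, and the remaining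
     a_ij is the shift present in [rho_rec]. *)
  have := rho_rec (dexp m) s i; rewrite /= -/b -/c.
  have -> : c i 0 = b i 0 - A i j *+ s by rewrite !mxE mulmxnE !mxE.
  rewrite rmorphB rmorphMn /= => rec.
  have sumE : \sum_(k | k != j) (A i k)%:~R * (pw (x + U_(k))%MM *
        (q ((x + U_(k))%MM j) * rho (b + col k A - col j A *+ ((x + U_(k))%MM j))))
     = - (pw x * q s * \sum_(k in S) (A i k)%:~R * rho (c + col k A)).
    rewrite -mulrN -sumrN mulr_sumr [RHS]big_mkcond [RHS](bigD1 j) //= (negbTE jS) add0r.
    apply: eq_bigr => k kj.
    rewrite mnmDE mnm1E (negbTE kj) addn0 -/s addrAC -/c.
    have -> : pw (x + U_(k))%MM = pw x * e k.
      rewrite /pw (bigD1 k) //= [in RHS](bigD1 k) //= mnmDE mnm1E eqxx addn1 exprSr.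
      rewrite mulrAC; congr (_ * _ * _); apply: eq_bigr => l /andP [_ /negbTE lk].
      by rewrite mnmDE mnm1E eq_sym lk addn0.
    by rewrite /e; case: ifP => _; ring.
  rewrite sumE -rec /wlift /lam -/x -/b -/s -/c.
  by rewrite -[_ *: _]/(_ * _) -[_ *+ s]mulr_natr -natr1; ring.
(* On x_j^m0 d^u0 the value is (-1)^m0 m0! times a nonzero value of [rho]. *)
have := quasi_iso_functional_eq0 qi lam0 lam_del lam_phi
  'X_[xpart (U_(j) *+ m0)%MM + dpart u0].
rewrite /= lextX /wlift /lam xexpD dexpD xexp_xpart xexp_dpart dexp_xpart dexp_dpart.
rewrite addm0 add0m mulmnE mnm1E eqxx mul1n /pw big1 => [|k kj]; last first.
  by rewrite mulmnE mnm1E eq_sym (negbTE kj) mul0n.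
move/eqP; rewrite mul1r mulf_eq0 (negbTE rho_nz) orbF /q mulf_eq0 signr_eq0 /=.
by rewrite pnatr_eq0 -leqn0 leqNgt fact_gt0.
Qed.

End Final.

Theorem theorem3p5 (d n : nat) (A : 'M[int]_(d, n))
  (hZA : ZA_full A) (hpos : NA_positive A)
  (beta : 'I_d -> CC) (j : 'I_n) :
  ~ SRes A j beta <-> dj_quasi_iso A beta j.
Proof.
split=> [|qi res]; first exact: nonresonant_quasi_iso.
exact: resonant_not_quasi_iso res qi.
Qed.
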